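(* Let $G$ be a graph of order $n$ having neither a component of order less than $3$ nor a component isomorphic to $K_{1,2u+1}$ for any integer $u\geq 1$. Then (i) $s_g(G)=n$ if $n\equiv 1 \pmod 2$; (ii) $s_g(G)=n+1$ if $n\equiv 2\pmod 4$; (iii) $s_g(G)\leq n+1$ if $n\equiv 0\pmod 4$.
   Context: Graphs are finite, simple and undirected; components are connected components, and the order of a graph is its number of vertices. For a finite Abelian group $\Gamma$ (written additively) and an edge labeling $f\colon E(G)\to\Gamma$, the weighted degree of a vertex $v$ is $w(v)=\sum_{u\in N(v)}f(uv)$, computed in $\Gamma$. The labeling $f$ is called $\Gamma$-irregular if $w(u)\neq w(v)$ for all distinct $u,v\in V(G)$. The group irregularity strength $s_g(G)$ is the smallest integer $s$ such that for every Abelian group $\Gamma$ of order $s$ there exists a $\Gamma$-irregular labeling of $G$. $K_{1,r}$ denotes the star with $r$ leaves. *)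

(* Defs.v *)
From mathcomp Require Import all_boot all_order all_algebra.

Set Implicit Arguments.
Unset Strict Implicit.
Unset Printing Implicit Defensive.

Import GRing.Theory.

Record sgraph := SGraph {
  svertex :> finType;
  sedge : rel svertex;
  sedge_sym : symmetric sedge;
  sedge_irrefl : irreflexive sedge }.

Arguments sedge {G} : rename.

Definition graph_iso (G H : sgraph) : Prop :=
  exists2 f : G -> H, bijective f & forall x y, sedge (f x) (f y) = sedge x y.

Section Induced.
Variables (G : sgraph) (C : {set G}).

Definition induced_edge : rel {x : G | x \in C} :=
  [rel x y | sedge (val x) (val y)].

Lemma induced_edge_sym : symmetric induced_edge.
Proof. by move=> x y; apply: sedge_sym. Qed.

Lemma induced_edge_irrefl : irreflexive induced_edge.
Proof. by move=> x; apply: sedge_irrefl. Qed.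

Definition induced : sgraph := SGraph induced_edge_sym induced_edge_irrefl.
End Induced.

(* The vertex sets of the connected components. *)
Definition components (G : sgraph) : {set {set G}} :=
  equivalence_partition (connect (@sedge G)) [set: G].

(* The star K_{1,r}: [None] is the centre and each [Some i] is a leaf. *)
Section Star.
Variable r : nat.

Definition star_edge : rel (option 'I_r) :=
  [rel x y | (x == None) != (y == None)].

Lemma star_edge_sym : symmetric star_edge.
Proof. by move=> x y; rewrite /star_edge /= eq_sym. Qed.

Lemma star_edge_irrefl : irreflexive star_edge.
Proof. by move=> x; rewrite /star_edge /= eqxx. Qed.

Definition star : sgraph := SGraph star_edge_sym star_edge_irrefl.
End Star.

(* An edge labeling is a function on unordered pairs of vertices; only its
   values on the edges [set u; v] are ever used. *)
Definition wdeg (G : sgraph) (A : finZmodType) (f : {set G} -> A) (v : G) : A :=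
  (\sum_(u | sedge v u) f [set u; v])%R.

Definition irregular (G : sgraph) (A : finZmodType) (f : {set G} -> A) : Prop :=
  forall u v : G, u != v -> wdeg f u != wdeg f v.

Definition all_groups_irregular (G : sgraph) (s : nat) : Prop :=
  forall A : finZmodType, #|A| = s -> exists f : {set G} -> A, irregular f.

(* [is_sg G s] says that the group irregularity strength of G exists and is s;
   it is a relation because the minimum may fail to exist (K_2, for instance,
   has no irregular labeling). Orders of groups are positive, so s = 0, for
   which [all_groups_irregular] holds vacuously, is excluded. *)
Definition is_sg (G : sgraph) (s : nat) : Prop :=
  [/\ 0 < s, all_groups_irregular G s &
      forall t, 0 < t -> all_groups_irregular G t -> s <= t].

(* Main.v *)
Require Import Defs.
From mathcomp Require Import all_boot all_order all_algebra.
From mathcomp Require Import all_fingroup all_solvable zify ring.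
From Stdlib Require Import Classical_Prop.

(** Let A be an abelian group of odd order m >= n. Propagating labels along
    walks with alternating signs shows that a weight function w is realised by a
    labelling as soon as, in every bipartite component, the sums of w over the
    two colour classes agree; in a non-bipartite component an odd closed walk
    realises 2g, hence any g, at a single vertex. So it suffices to find an
    injective w that is balanced in this sense.

    Call {±a, ±b, ±(a+b)} a hexad if its six elements are distinct. A hexad is
    the union of {a+b, a, b} and {-(a+b), -a, -b}, which serve two components of
    odd order: the sum is put on a vertex of one colour and the summands on two
    vertices of the other. Alternatively its two zero-sum triples serve the two
    colour classes of a component in which both are odd; excluding the stars
    K_{1,2u+1} makes these classes have at least three vertices. All other
    vertices get pairs {x, -x} inside a colour class, and one vertex gets 0 if n
    is odd.

    What is needed is therefore the theorem of Tannenbaum that A contains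
    floor((m-1)/6) disjoint hexads. For cyclic A they come from Skolem and hooked
    Skolem sequences. Otherwise A has a quotient Q = (Z/p)^2, with kernel H, and
    disjoint hexads of Q lift to disjoint hexads (a+h, b+h), h in H, of A; one
    recurses on H if p > 3, where Q minus 0 is partitioned into hexads by an
    automorphism of order 6, and on a subgroup of index 3 if p = 3. *)

Set Implicit Arguments.
Unset Strict Implicit.
Unset Printing Implicit Defensive.

Import GRing.Theory.

(** * Skolem sequences *)

(** [a d] is the left end of the pair at distance [d] among [1 .. 2t+1], and [h]
    is the free position: [h = 2t+1] is a Skolem, [h = 2t] a hooked Skolem
    sequence. *)
Definition skolem_like (t : nat) (a : nat -> nat) (h : nat) : Prop :=
  forall d e, 0 < d <= t -> 0 < e <= t ->
  [/\ 0 < a d, a d + d <= 2 * t + 1, a d <> h & a d + d <> h] /\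
  [/\ a d = a e -> d = e, a d + d = a e + e -> d = e & a d <> a e + e].

(** The explicit families give the left end by the parity and the half of the distance; in these
    coordinates every condition is linear arithmetic. *)
Lemma skolem_like_halves t g h :
  (forall (b c : bool) k l, 0 < b + 2 * k <= t -> 0 < c + 2 * l <= t ->
    [/\ 0 < g b k, g b k + (b + 2 * k) <= 2 * t + 1, g b k <> h
      & g b k + (b + 2 * k) <> h] /\
    [/\ g b k = g c l -> b + 2 * k = c + 2 * l,
        g b k + (b + 2 * k) = g c l + (c + 2 * l) -> b + 2 * k = c + 2 * l
      & g b k <> g c l + (c + 2 * l)]) ->
  skolem_like t (fun d => g (odd d) d./2) h.
Proof.
move=> H d e dt et.
have Ed : odd d + 2 * d./2 = d by rewrite mul2n odd_double_half.
have Ee : odd e + 2 * e./2 = e by rewrite mul2n odd_double_half.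
by have := H (odd d) (odd e) d./2 e./2; rewrite Ed Ee; apply.
Qed.

(* The next four families are the explicit sequences of Skolem and O'Keefe. *)
Lemma skolem_4s s : 1 < s -> exists a, skolem_like (4 * s) a (8 * s + 1).
Proof.
move=> s2; pose g (b : bool) k := if ~~ b then 6 * s - k
  else if k == 0 then s else if k == s - 1 then 2 * s else if k == s then s - 1
  else if k == 2 * s - 1 then 2 * s + 1
  else if k < s then 2 * s - k else 2 * s - 1 - k.
exists (fun d => g (odd d) d./2); apply: skolem_like_halves => b c k l dt et.
rewrite /g; case: b dt => /= dt; case: c et => /= et; repeat case: ifPn => ?;
split; split; lia.
Qed.

Lemma skolem_4s1 s : 1 < s -> exists a, skolem_like (4 * s + 1) a (8 * s + 3).
Proof.
move=> s2; pose g (b : bool) k := if ~~ b then 6 * s + 2 - k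
  else if k == 0 then s + 1 else if k == s - 1 then 2 * s + 2
  else if k == 2 * s then 2 * s + 1
  else if k < s then 2 * s + 1 - k else 2 * s - k.
exists (fun d => g (odd d) d./2); apply: skolem_like_halves => b c k l dt et.
rewrite /g; case: b dt => /= dt; case: c et => /= et; repeat case: ifPn => ?;
split; split; lia.
Qed.

Lemma skolem_4s2 s : 0 < s -> exists a, skolem_like (4 * s + 2) a (8 * s + 4).
Proof.
move=> s1; pose g (b : bool) k :=
  if ~~ b then if k == 2 * s + 1 then 4 * s + 3 else 2 * s + 1 - k
  else if k == 0 then 7 * s + 3 else if k == s then 4 * s + 2
  else if k == 2 * s then 2 * s + 1
  else if k < s then 6 * s + 2 - k else 6 * s + 3 - k.
exists (fun d => g (odd d) d./2); apply: skolem_like_halves => b c k l dt et.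
rewrite /g; case: b dt => /= dt; case: c et => /= et; repeat case: ifPn => ?;
split; split; lia.
Qed.

Lemma skolem_4s3 s : 1 < s -> exists a, skolem_like (4 * s - 1) a (8 * s - 2).
Proof.
move=> s2; pose g (b : bool) k :=
  if ~~ b then if k == 2 * s - 1 then 2 * s + 1 else 6 * s - 1 - k
  else if k == 0 then s else if k == s - 1 then 2 * s else if k == s then s - 1
  else if k == 2 * s - 1 then 4 * s
  else if k < s then 2 * s - k else 2 * s - 1 - k.
exists (fun d => g (odd d) d./2); apply: skolem_like_halves => b c k l dt et.
rewrite /g; case: b dt => /= dt; case: c et => /= et; repeat case: ifPn => ?;
split; split; lia.
Qed.

Lemma skolem_small t : t <= 5 ->
  exists a h, (h = 2 * t \/ h = 2 * t + 1) /\ skolem_like t a h.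
Proof.
(* Entry [t] of the table lists the left ends for the distances 1, ..., t. The sequences for [t = 2]
   and [t = 3] are hooked, the others are Skolem sequences. *)
move=> t5; pose s := nth [::] [:: [::]; [:: 1]; [:: 1; 3]; [:: 2; 5; 1];
  [:: 7; 2; 3; 1]; [:: 9; 2; 5; 3; 1]] t.
exists (fun d => nth 0 s d.-1), (2 * t + ~~ ((t == 2) || (t == 3))).
split; first by case: (~~ _); [right | left; rewrite addn0].
rewrite {}/s; case: t t5 => [|[|[|[|[|[|//]]]]]] _ d e;
by case: d => [|[|[|[|[|[|d]]]]]] //; case: e => [|[|[|[|[|[|e]]]]]].
Qed.

Lemma skolem t :
  exists a h, (h = 2 * t \/ h = 2 * t + 1) /\ skolem_like t a h.
Proof.
have [/skolem_small//|t5] := leqP t 5.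
have E := divn_eq t 4; have := ltn_pmod t (isT : 0 < 4).
set s := t %/ 4 in E; case: (t %% 4) E => [|[|[|[|//]]]] E _.
- have [|a aP] := @skolem_4s s; first lia.
  by exists a, (8 * s + 1); split; [lia | have -> : t = 4 * s by lia].
- have [|a aP] := @skolem_4s1 s; first lia.
  by exists a, (8 * s + 3); split; [lia | have -> : t = 4 * s + 1 by lia].
- have [|a aP] := @skolem_4s2 s; first lia.
  by exists a, (8 * s + 4); split; [lia | have -> : t = 4 * s + 2 by lia].
- have [|a aP] := @skolem_4s3 s.+1; first lia.
  by exists a, (8 * s.+1 - 2); split; [lia | have -> : t = 4 * s.+1 - 1 by lia].
Qed.

(** * Disjoint hexads in abelian groups of odd order *)

Section Quotient.
Local Open Scope group_scope.
(** A basis of [G] whose orders successively divide each other has at least two members [x], [y]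
    when [G] is not cyclic, and a prime [p] dividing the order of [y] also divides that of [x]. With
    [H] generated by the p-th powers of [x] and [y] and the remaining basis elements, the quotient
    is (Z/p)^2 with basis the images of [x] and [y]. *)
Lemma noncyclic_rank2_quotient (gT : finGroupType) (G : {group gT}) :
  abelian G -> ~~ cyclic G ->
  exists p (H : {group gT}) (x y : gT),
    [/\ prime p, H \subset G, #|G| = (p ^ 2 * #|H|)%N,
        [/\ x \in G, y \in G, (x ^+ p) \in H & (y ^+ p) \in H]
      & forall i j, (x ^+ i * y ^+ j) \in H -> p %| i /\ p %| j].
Proof.
move=> abG ncG; have [b defG eq_b] := abelian_structure abG.
have := abelian_type_dvdn_sorted G; have := abelian_type_gt1 G; rewrite -eq_b.
case: b defG {eq_b} => [|x [|y s]].
- by rewrite big_nil => G1; rewrite -G1 cyclic1 in ncG.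
- by rewrite big_seq1 => G1; rewrite -G1 cycle_cyclic in ncG.
rewrite big_cons => /= defG /and3P[_ y1 _] /andP[dvd_yx _].
case/dprodP: defG => [[_ M _ defM] mulxM _ tixM]; rewrite defM in mulxM tixM.
move: defM; rewrite big_cons => /dprodP[[_ R _ defR] mulyR _ tiyR].
rewrite defR in mulyR tiyR.
set p := pdiv #[y]; have p_pr : prime p by rewrite pdiv_prime.
have p_y : p %| #[y] := pdiv_dvd _; have p_x : p %| #[x] := dvdn_trans p_y dvd_yx.
clearbody p.
have sxG : <[x]> \subset G by rewrite -mulxM mulG_subl.
have sMG : M \subset G by rewrite -mulxM mulG_subr.
have syM : <[y]> \subset M by rewrite -mulyR mulG_subl.
have sRM : R \subset M by rewrite -mulyR mulG_subr.
have cG (U V : {group gT}) : U \subset G -> V \subset G -> V \subset 'C(U).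
  by move=> sU sV; apply: (centSS sV sU abG).
have sxp := cycleX x p; have syp := cycleX y p.
pose L := (<[(y ^+ p)]> <*> R)%G; pose H := (<[(x ^+ p)]> <*> L)%G.
have syG := subset_trans syM sMG; have sRG := subset_trans sRM sMG.
have sLM : L \subset M by rewrite join_subG (subset_trans syp).
have eL : L = <[(y ^+ p)]> * R :> {set gT}.
  by rewrite /= cent_joinEr // cG // (subset_trans syp).
have eH : H = <[(x ^+ p)]> * L :> {set gT}.
  by rewrite /= cent_joinEr // cG // ?(subset_trans sxp) ?(subset_trans sLM).
have cardX (z : gT) : p %| #[z] -> #[z] = (p * #[z ^+ p])%N.
  by move=> pz; rewrite orderXdiv // mulnC divnK.
exists p, H, x, y; split=> //.
- by rewrite join_subG (subset_trans sxp) // (subset_trans sLM).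
- have ti1 : <[(x ^+ p)]> :&: L = 1.
    by apply/trivgP; rewrite -tixM setISS.
  have ti2 : <[(y ^+ p)]> :&: R = 1.
    by apply/trivgP; rewrite -tiyR setSI.
  rewrite -mulxM eH TI_cardMg // [in RHS]TI_cardMg // -mulyR eL.
  rewrite TI_cardMg // [in RHS]TI_cardMg // -!orderE (cardX x) // (cardX y) //.
  by rewrite -mulnn -!mulnA; congr (p * _)%N; rewrite mulnCA.
- split; first exact: (subsetP sxG _ (cycle_id x)).
    exact: (subsetP syG _ (cycle_id y)).
    have sxH : <[x ^+ p]> \subset H := joing_subl _ _.
    exact: (subsetP sxH _ (cycle_id _)).
  have sLH : L \subset H := joing_subr _ _.
  have syL : <[y ^+ p]> \subset L := joing_subl _ _.
  exact: (subsetP sLH _ (subsetP syL _ (cycle_id _))).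
have TI (U V : {group gT}) u u' v v' : U :&: V = 1 -> u \in U -> u' \in U ->
    v \in V -> v' \in V -> (u * v = u' * v') -> u = u' /\ v = v'.
  move=> ti uU u'U vV v'V e.
  have : (u'^-1 * u) \in U :&: V.
    rewrite inE groupM ?groupV //=.
    have -> : (u'^-1 * u = v' * v^-1) by rewrite -(mulgK v u) e !mulgA mulVg mul1g.
    by rewrite groupM ?groupV.
  rewrite ti => /set1P e1; have eu : u = u' by rewrite -[RHS]mulg1 -e1 mulKVg.
  by split=> //; move: e; rewrite eu => /mulgI.
have dvd (z : gT) i k : p %| #[z] -> (z ^+ i = z ^+ p ^+ k) -> p %| i.
  move=> pz /eqP; rewrite -expgM eq_expg_mod_order => e.
  have : i = (p * k)%N %[mod p] by rewrite -(modn_dvdm i pz) (eqP e) modn_dvdm.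
  by rewrite modnMr => /eqP.
(* Factors are unique in the direct product [<[x]> * M], then in [<[y]> * R]; so each of the two
   powers is a power of a p-th power. *)
move=> i j; rewrite -[(_ * _) \in _]/(_ \in (H : {set gT})) eH.
case/mulsgP=> _ l /cycleP[k ->] lL e.
have [||||eqx eqy] := TI _ _ _ _ _ _ tixM _ _ _ _ e.
- exact: mem_cycle.
- by rewrite -expgM mem_cycle.
- by rewrite (subsetP syM) ?mem_cycle.
- exact: (subsetP sLM).
split; first exact: dvd eqx.
move: lL; rewrite -eqy -[_ \in _]/(_ \in (L : {set gT})) eL.
case/mulsgP=> _ r /cycleP[m ->] rR e'.
have [|||||] := TI _ _ (y ^+ j) (y ^+ p ^+ m) 1 r tiyR.
- exact: mem_cycle.
- by rewrite -expgM mem_cycle.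
- exact: group1.
- exact: rR.
- by rewrite mulg1.
by move=> ey _; apply: dvd ey.
Qed.
End Quotient.

Local Open Scope ring_scope.

(** Indexing the six elements of a hexad by position and sign turns distinctness inside a hexad and
    disjointness of hexads into a single injectivity statement. *)
Definition hexval (A : zmodType) (a b : A) (c : 'I_3 * bool) : A :=
  let x := nth 0 [:: a + b; a; b] c.1 in if c.2 then - x else x.

Definition hex_disjoint (A : zmodType) (I : Type) (a b : I -> A) :=
  injective (fun ic : I * ('I_3 * bool) => hexval (a ic.1) (b ic.1) ic.2).

Definition hexes (A : finZmodType) (G : {set A}) (I : finType) (a b : I -> A) :=
  (forall i, a i \in G /\ b i \in G) /\ hex_disjoint a b.

Section Hexes.
Variable A : finZmodType.
Implicit Types (G H K : {group A}) (x y : A).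

Lemma group_add G x y : x \in G -> y \in G -> x + y \in G.
Proof. exact: groupM. Qed.

Lemma group_opp G x : (- x \in G) = (x \in G).
Proof. exact: groupV. Qed.

Lemma group_sub G x y : x \in G -> y \in G -> x - y \in G.
Proof. by move=> xG yG; rewrite group_add ?group_opp. Qed.

Lemma double_inj G x y :
  odd #|G| -> x \in G -> y \in G -> x + x = y + y -> x = y.
Proof.
move=> oG xG yG e; apply/eqP; rewrite -subr_eq0.
have dvd2 : (#[(x - y)%R]%g %| 2)%N.
  rewrite order_dvdn; apply/eqP; rewrite FinRing.zmodXgE mulr2n addrACA e.
  by rewrite addrACA subrr addr0.
have : (#[(x - y)%R]%g %| gcdn #|G| 2)%N.
  by rewrite dvdn_gcd dvd2 (order_dvdG (group_sub xG yG)).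
rewrite (eqP (_ : coprime #|G| 2)) ?coprimen2 // dvdn1 order_eq1.
by [].
Qed.
End Hexes.

(** Shifting the positions of a Skolem-like sequence by [t], each distance d with left end s(d)
    gives the triple d, t + s(d), t + s(d) + d, whose last term is the sum of the others. Over all d
    these are distinct numbers between 1 and 3t + 1, and their multiples of [g] form the hexads. *)
Lemma hexes_cyclic (A : finZmodType) (g : A) (t : nat) :
  odd #[g]%g -> (6 * t < #[g]%g)%N ->
  exists a b : 'I_t -> A, hexes <[g]>%g a b.
Proof.
set m := #[g]%g => om tm; have [s [h [hE sP]]] := skolem t.
pose N (i : 'I_t) (k : 'I_3) :=
  nth 0%N [:: i.+1 + (t + s i.+1); i.+1; t + s i.+1]%N k.
have Ninj i j k l : N i k = N j l -> i = j /\ k = l.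
  have [||[P1 P2 _ _] [_ _ P7]] := sP j.+1 i.+1; [exact: ltn_ord..|].
  have [||[R1 R2 _ _] [R5 R6 R7]] := sP i.+1 j.+1; [exact: ltn_ord..|].
  have := ltn_ord i; have := ltn_ord j => jt it.
  case: k => [[|[|[|//]]] kp]; case: l => [[|[|[|//]]] lp]; rewrite /N /= => e;
    try (exfalso; lia); split; apply: val_inj => //=; last 1 first.
  - by apply: succn_inj; apply: R5; lia.
  - by apply: succn_inj; apply: R6; lia.
  - lia.
have Nle i k : (0 < N i k <= 3 * t + 1)%N && (N i k != t + h)%N.
  have [||[P1 P2 P3 P4] _] := sP i.+1 i.+1; [exact: ltn_ord| exact: ltn_ord|].
  have := ltn_ord i => it.
  by case: k => [[|[|[|//]]] kp] /=; rewrite /N /=; lia.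
exists (fun i => g *+ i.+1), (fun i => g *+ (t + s i.+1)); split.
  by move=> i; split; rewrite -FinRing.zmodXgE mem_cycle.
have E : forall (i : 'I_t) (c : 'I_3 * bool), hexval (g *+ i.+1) (g *+ (t + s i.+1)) c =
    if c.2 then - (g *+ N i c.1) else g *+ N i c.1.
  by move=> i [[[|[|[|//]]] kp] b]; rewrite /hexval /N /= ?mulrnDr.
have pos (i j : 'I_t) (k l : 'I_3) : g *+ N i k = g *+ N j l -> i = j /\ k = l.
  move/eqP; rewrite -!FinRing.zmodXgE eq_expg_mod_order -/m => /eqP e; apply: Ninj.
  have := Nle i k; have := Nle j l => L1 L2.
  have it := ltn_ord i; by move: e; rewrite !modn_small; lia.
(* Two different numbers add up to at most 6t: either 3t + 1 is the free number, or 3t is, and then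
   the largest sum is (3t + 1) + (3t - 1). A number equal to its own negative is excluded by the odd
   order. *)
have neg (i j : 'I_t) (k l : 'I_3) : g *+ N i k <> - (g *+ N j l).
  move/eqP; rewrite -subr_eq0 opprK -mulrnDr -FinRing.zmodXgE -order_dvdn -/m => e.
  have := Nle i k; have := Nle j l => L1 L2.
  have t0 : (0 < t)%N := leq_ltn_trans (leq0n _) (ltn_ord i).
  case: (eqVneq (N i k) (N j l)) => [eN|nN].
    move: e; rewrite eN addnn -muln2 Gauss_dvdl ?coprimen2 // => /dvdn_leq; lia.
  by move/dvdn_leq: e; lia.
move=> [i [k b]] [j [l c]] /=; rewrite !E /=; case: b; case: c.
- by move/oppr_inj/pos => [-> ->].
- by move/esym/neg.
- by move/neg.
- by move/pos => [-> ->].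
Qed.

Lemma hexval_in (A : finZmodType) (G : {group A}) (a b : A) c :
  a \in G -> b \in G -> hexval a b c \in G.
Proof.
move=> aG bG; case: c => [[[|[|[|//]]] kp] [|]]; rewrite /hexval /= ?group_opp //;
exact: group_add.
Qed.

Lemma hexes_union (A : finZmodType) (G K : {group A}) (I J : finType)
    (a b : I -> A) (a' b' : J -> A) :
  K \subset G -> hexes K a b -> hexes G a' b' ->
  (forall j c, hexval (a' j) (b' j) c \notin K) ->
  exists f g : I + J -> A, hexes G f g.
Proof.
move=> sKG [abK dab] [abG dab'] notK.
pose f (ij : I + J) := match ij with inl i => a i | inr j => a' j end.
pose g (ij : I + J) := match ij with inl i => b i | inr j => b' j end.
exists f, g; split; first by case=> [i|j] //=; have [? ?] := abK i; rewrite !(subsetP sKG).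
have inK i c : hexval (a i) (b i) c \in K by have [] := abK i; apply: hexval_in.
case=> [[i|i] c] [[j|j] d] //= e.
- by have [-> ->] := @dab (i, c) (j, d) e.
- by have := notK j d; rewrite -e inK.
- by have := notK i c; rewrite e inK.
- by have [-> ->] := @dab' (i, c) (j, d) e.
Qed.

(** * Lifting hexads along a section of a quotient map *)

Section Lift.
Variables (A : finZmodType) (Q : zmodType) (G H : {group A}) (r : Q -> A).
Hypotheses (sHG : H \subset G) (rG : forall q, r q \in G) (oH : odd #|H|).
Hypothesis r_inj : forall q q', r q - r q' \in H -> q = q'.
Hypothesis r_add : forall q q', r (q + q') - (r q + r q') \in H.

Lemma section0 : r 0 \in H.
Proof. by have := r_add 0 0; rewrite addr0 opprD addNKr group_opp. Qed.

Lemma section_opp q : r (- q) + r q \in H.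
Proof.
have := group_sub section0 (r_add (- q) q).
by rewrite addNr subKr.
Qed.

Lemma section_muln q n : r (q *+ n) - r q *+ n \in H.
Proof.
elim: n => [|n IH]; first by rewrite !mulr0n subr0 section0.
have := group_add (r_add q (q *+ n)) IH; rewrite -mulrS.
by rewrite opprD !addrA addrNK [r q *+ _.+1]mulrS opprD addrA.
Qed.

Definition hex_lift (I : finType) (a : I -> Q) (ih : I * {x : A | x \in H}) : A :=
  r (a ih.1) + val ih.2.

Variables (I : finType) (a b : I -> Q).

Lemma hexval_lift ih c :
  r (hexval (a ih.1) (b ih.1) c) - hexval (hex_lift a ih) (hex_lift b ih) c \in H.
Proof.
case: ih => i h /=; have hH : sval h \in H := valP h; rewrite /hex_lift /=.
set u := a i; set v := b i; move: (sval h) hH => x xH.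
have opp q y : r q - y \in H -> r (- q) + y \in H.
  by move=> yH; have := group_sub (section_opp q) yH; rewrite opprB addrACA subrr addr0.
have pos k : r (hexval u v (k, false)) - hexval (r u + x) (r v + x) (k, false) \in H.
  case: k => [[|[|[|//]]] kp]; rewrite /hexval /=.
  - by rewrite addrACA opprD addrA group_sub // group_add.
  - by rewrite opprD addrA subrr sub0r group_opp.
  - by rewrite opprD addrA subrr sub0r group_opp.
case: c => k [|]; last exact: pos.
by have := opp _ _ (pos k); rewrite /hexval /= opprK.
Qed.

(** Modulo [H] an equality identifies the hexad and the position, by disjointness in [Q]. The shift
    h is then recovered by cancellation, except that it enters the sum position twice; there the odd
    order of [H] permits halving. *)
Lemma hexes_lift : hex_disjoint a b -> hexes G (hex_lift a) (hex_lift b).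
Proof.
move=> dab; split.
  by move=> [i h]; rewrite /hex_lift /= !group_add ?(subsetP sHG _ (valP h)).
move=> [ih c] [jl d] /= e.
have eq_hex : hexval (a ih.1) (b ih.1) c = hexval (a jl.1) (b jl.1) d.
  apply: r_inj; have := group_sub (hexval_lift ih c) (hexval_lift jl d).
  by rewrite e opprB addrA addrNK.
have [eij ecd] := @dab (ih.1, c) (jl.1, d) eq_hex.
case: ih jl eij e {eq_hex} => i h [_ l] /= <-; rewrite -{}ecd /hexval /hex_lift /=.
move=> e; suff -> : h = l by [].
apply: val_inj; case: c e => [[[|[|[|//]]] kp] s] /= e.
- apply: (double_inj oH (valP h) (valP l)).
  apply: (@addrI _ (r (a i) + r (b i))); rewrite addrACA [RHS]addrACA.
  by case: s e => // /oppr_inj.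
- by case: s e => [/oppr_inj|] /addrI.
- by case: s e => [/oppr_inj|] /addrI.
Qed.

End Lift.

(** * Partition of the nonzero vectors of (Z/p)^2 into hexads, p > 3 *)

Section RootOfUnity.
Variable p : nat.
Hypotheses (p_pr : prime p) (p5 : (4 < p)%N).

(* Multiplication by a primitive sixth root of unity in the ring F_p[X]/(X^2 - X + 1):
   [rot6^2 q = rot6 q - q] and [rot6^3 q = - q]. *)
Definition rot6 (q : 'F_p * 'F_p) : 'F_p * 'F_p := (- q.2, q.1 + q.2).

Lemma rot6_inj : injective rot6.
Proof.
move=> [u v] [u' v'] e; have e1 : - v = - v' := congr1 fst e.
by have : u + v = u' + v' := congr1 snd e; rewrite (oppr_inj e1) => /addIr->.
Qed.

Lemma Fp_mulrn_eq0 n (u : 'F_p) : (0 < n < p)%N -> u *+ n = 0 -> u = 0.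
Proof.
move=> /andP[n0 np]; rewrite -mulr_natr => /eqP; rewrite mulf_eq0.
case/orP=> [/eqP//|]; rewrite -(dvdn_pcharf (pchar_Fp p_pr)) => /dvdn_leq.
by move/(_ n0); rewrite leqNgt np.
Qed.

Lemma iter6_rot6 q : iter 6 rot6 q = q.
Proof.
case: q => u v; rewrite /rot6 /=; congr pair; ring.
Qed.

(** A shorter orbit gives linear equations forcing a coordinate, or its double or triple, to vanish;
    2 and 3 are invertible since [p] exceeds 3. *)
Lemma order_rot6 q : q != 0 -> fingraph.order rot6 q = 6.
Proof.
move=> q0; set n := fingraph.order rot6 q.
have n0 : (0 < n)%N := fingraph.order_gt0 _ _.
have itn : iter n rot6 q = q := iter_order rot6_inj q.
have n6 : (n <= 6)%N.
  rewrite leqNgt; apply/negP => n6.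
  by have := findex_iter n6; rewrite iter6_rot6 findex0.
case: q q0 @n n0 itn n6 => u v q0 n n0 itn n6.
have [//|n_neq] := eqVneq n 6; case/eqP: q0.
suff [-> ->] : u = 0 /\ v = 0 by [].
have F2 : forall w : 'F_p, w *+ 2 = 0 -> w = 0 by move=> w; apply: Fp_mulrn_eq0; lia.
have F3 : forall w : 'F_p, w *+ 3 = 0 -> w = 0 by move=> w; apply: Fp_mulrn_eq0; lia.
move: n0 itn n6 n_neq; case: n => [|[|[|[|[|[|[|//]]]]]]] // _; rewrite /rot6 /=.
all: move=> e _ _; move: (congr1 fst e) (congr1 snd e) => /= {e} e1 e2.
- have u0 : u = 0 by rewrite -(addrK v u) e2 subrr.
  by split=> //; rewrite -[v]opprK e1 u0 oppr0.
- have e : u = v by rewrite -[RHS]e2; ring.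
  have u0 : u = 0 by apply: F3; rewrite mulrS mulr2n -{1}e1 -e; ring.
  by rewrite -e u0.
- have e1' : - u = u by rewrite -[RHS]e1; ring.
  have e2' : - v = v by rewrite -[RHS]e2; ring.
  by split; apply: F2; rewrite mulr2n; [rewrite -{1}e1' | rewrite -{1}e2']; rewrite addNr.
- have e : v = u by rewrite -[RHS]e1; ring.
  have e' : - u - v = v by rewrite -[RHS]e2; ring.
  have v0 : v = 0 by apply: F3; rewrite mulrS mulr2n -{1}e' e; ring.
  by rewrite -e v0.
- have e : u + v = u by rewrite -[RHS]e1; ring.
  have e' : - u = v by rewrite -[RHS]e2; ring.
  have v0 : v = 0 by rewrite -(addKr u v) e addNr.
  by split=> //; rewrite -[u]opprK e' v0 oppr0.
Qed.

(** Each orbit of [rot6] on nonzero vectors is a hexad: q and [rot6]^2 q have sum [rot6] q, and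
    [rot6]^3 negates. One root per orbit serves as index. *)
Lemma hex_disjoint_Fp2 : exists (I : finType) (a b : I -> 'F_p * 'F_p),
  (6 * #|I|)%N = (p ^ 2).-1 /\ hex_disjoint a b.
Proof.
pose nz : {pred 'F_p * 'F_p} := fun q => q != 0.
have fcl : fclosed rot6 nz.
  move=> x _ /eqP<-; rewrite !unfold_in; congr (~~ _).
  by apply/eqP/eqP => [->|]; [rewrite /rot6 /= oppr0 addr0
    | move=> e; apply: rot6_inj; rewrite e /rot6 /= oppr0 addr0].
have := fcard_order_set rot6_inj (n := 6%N) (a := nz) _ fcl.
have -> : #|nz| = (p ^ 2).-1.
  have := cardC1 (0 : 'F_p * 'F_p); rewrite card_prod !card_Fp // mulnn => <-.
case/(_ _)/wrap => [|eqI]; first by apply/subsetP => q; rewrite !unfold_in => /order_rot6->.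
pose R := [pred q | (froot rot6 q == q) && (q != 0)].
pose I := {q : 'F_p * 'F_p | q \in R}.
exists I, (fun i => val i), (fun i => rot6 (rot6 (val i))); split.
  rewrite mulnC -eqI; congr (_ * _)%N; rewrite card_sig; apply: eq_card => q.
  by rewrite !inE.
(* The exponent of [rot6] that yields each position: 1, 0, 2 for a + b, a, b, and three more for
   their negatives. *)
pose code (c : 'I_3 * bool) := nth 0%N (if c.2 then [:: 4; 3; 5]%N else [:: 1; 0; 2]%N) c.1.
have codeP (i : I) c : hexval (val i) (rot6 (rot6 (val i))) c = iter (code c) rot6 (val i).
  case: i => [[u v] ?]; case: c => [[[|[|[|//]]] kp] [|]]; 
    rewrite /hexval /code /= /rot6 //=; congr pair; rewrite /=; ring.
have code_lt c : (code c < 6)%N by case: c => [[[|[|[|//]]] kp] [|]].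
have code_inj : injective code.
  move=> [[[|[|[|//]]] kp] [|]] [[[|[|[|//]]] lp] [|]] //= _; congr pair; exact: val_inj.
move=> [i c] [j d] /=; rewrite !codeP => e.
have /andP[/eqP ri i0] := valP i; have /andP[/eqP rj j0] := valP j.
have eij : val i = val j.
  rewrite -ri -rj; apply/eqP; rewrite root_connect; last exact: fconnect_sym rot6_inj.
  apply: connect_trans (fconnect_iter _ (code c) _) _; rewrite e.
  by rewrite fconnect_sym; [exact: fconnect_iter | exact: rot6_inj].
have /val_inj-> := eij; congr pair; apply: code_inj.
move: e; rewrite eij => e.
rewrite -(@findex_iter _ rot6 (val j) (code c)) ?order_rot6 //.
by rewrite e findex_iter ?order_rot6.
Qed.
End RootOfUnity.

(** This one hexad leaves out exactly the line spanned by (1, -1). *)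
Lemma hex_disjoint_F3 :
  hex_disjoint (fun _ : unit => (1, 0) : 'F_3 * 'F_3) (fun _ => (0, 1)).
Proof.
move=> [[] [[[|[|[|//]]] kp] s]] [[] [[[|[|[|//]]] lp] u]]; case: s; case: u => /eqP //= _;
congr (_, (_, _)); exact: val_inj.
Qed.

(** Zero is its own negative and would occupy two positions of one hexad. *)
Lemma hex_disjoint_neq0 (A : zmodType) (I : Type) (a b : I -> A) i c :
  hex_disjoint a b -> hexval (a i) (b i) c != 0.
Proof.
move=> dab; apply/eqP => e0; have := @dab (i, c) (i, (c.1, ~~ c.2)).
rewrite /= e0; case: c e0 => k s; rewrite /hexval /= => e0.
have -> : nth 0 [:: a i + b i; a i; b i] k = 0.
  by case: s e0 => // /eqP; rewrite oppr_eq0 => /eqP.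
by case: s {e0}; rewrite /= ?oppr0 => /(_ erefl).
Qed.

(** * Coset representatives for the quotient (Z/p)^2 *)

Section Quotient.
Variables (A : finZmodType) (G H : {group A}) (p : nat) (x y : A).
Hypotheses (p_pr : prime p) (sHG : H \subset G) (xG : x \in G) (yG : y \in G).
Hypotheses (xpH : x *+ p \in H) (ypH : y *+ p \in H).
Hypothesis indep : forall i j : nat,
  x *+ i + y *+ j \in H -> (p %| i)%N /\ (p %| j)%N.

(* Coset representatives of [H], additive only modulo [H]. *)
Definition quo_rep (q : 'F_p * 'F_p) : A := x *+ q.1 + y *+ q.2.

Lemma quo_rep_in q : quo_rep q \in G.
Proof. by rewrite group_add //; apply: (@groupX A). Qed.

Lemma quo_rep_inj q q' : quo_rep q - quo_rep q' \in H -> q = q'.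
Proof.
case: q q' => [i j] [i' j']; rewrite /quo_rep /= => memH.
have lt_p (k : 'F_p) : (k < p)%N by have := ltn_ord k; rewrite [X in (_ < X)%N]Fp_cast.
have eq_val (k l : 'F_p) : (p %| k + (p - l))%N -> k = l.
  move=> dvd; apply: val_inj => /=; have := lt_p k; have := lt_p l => lp kp.
  move: dvd; have [le_lk|lt_kl] := leqP l k.
    have -> : (k + (p - l) = p + (k - l))%N by lia.
    by rewrite dvdn_addr // => /dvdn_leq; lia.
  by move/dvdn_leq; lia.
(* [indep] speaks of natural multiples, so k - l is replaced by k + (p - l), at the cost of
   [z *+ p], which lies in [H] for both generators. *)
have split_sub (z : A) (k l : 'F_p) : z *+ (k + (p - l)) = z *+ k - z *+ l + z *+ p.
  by rewrite mulrnDr mulrnBr 1?ltnW // addrA addrAC.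
have : x *+ (i + (p - i')) + y *+ (j + (p - j')) \in H.
  rewrite !split_sub addrACA; apply: group_add; last exact: group_add.
  by move: memH; rewrite opprD addrACA.
by case/indep => /eq_val-> /eq_val->.
Qed.

Lemma quo_rep_add q q' : quo_rep (q + q') - (quo_rep q + quo_rep q') \in H.
Proof.
case: q q' => [i j] [i' j']; rewrite /quo_rep /=.
have add_mod (z : A) (k l : 'F_p) : z *+ p \in H ->
    z *+ (k + l)%R - (z *+ k + z *+ l) \in H.
  move=> zpH; have -> : nat_of_ord (k + l)%R = ((k + l) %% p)%N.
    by rewrite /= [X in (_ %% X)%N]Fp_cast.
  rewrite -mulrnDr {2}(divn_eq (k + l) p) mulrnDr opprD addrCA subrr addr0.
  by rewrite group_opp mulnC mulrnA; apply: (@groupX A).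
have := group_add (add_mod x i i' xpH) (add_mod y j j' ypH).
by rewrite addrACA -opprD [x *+ i + _ + _]addrACA.
Qed.
End Quotient.

(** The bound says that the number of hexads is at least floor((|G| - 1)/6). The recursion preserves
    it because the lifted hexads cover all of [G] outside the subgroup recursed on. *)
Theorem hexes_exist (A : finZmodType) (G : {group A}) : odd #|G| ->
  exists (I : finType) (a b : I -> A), (#|G| <= 6 * #|I| + 6)%N /\ hexes G a b.
Proof.
have [n] := ubnP #|G|; elim: n G => // n IHn G ltGn oG.
have abG : abelian G := FinRing.zmod_abelian _.
case: (boolP (cyclic G)) => [/cyclicP[g defG]|ncG].
  have [||a [b ab]] := @hexes_cyclic A g ((#|G|.-1) %/ 6).
  - by rewrite orderE -defG.
  - rewrite orderE -defG; move: (cardG_gt0 G); move: #|G| => m m0.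
    lia.
  exists _, a, b; rewrite -defG in ab; split=> //.
  by rewrite card_ord; have := cardG_gt0 G; lia.
have [p [H [x [y [p_pr sHG cardG [xG yG xpH ypH] indep]]]]] :=
  noncyclic_rank2_quotient abG ncG.
have [op oH] : odd p /\ odd #|H| by move: oG; rewrite cardG oddM oddX /= => /andP[].
have p1 := prime_gt1 p_pr; have H0 := cardG_gt0 H.
pose r := quo_rep (p := p) x y.
have rG q : r q \in G by apply: quo_rep_in.
have r_inj : forall q q', r q - r q' \in H -> q = q'.
  by move=> q q'; exact: (quo_rep_inj p_pr sHG xG yG xpH ypH indep).
have r_add : forall q q', r (q + q') - (r q + r q') \in H by apply: quo_rep_add.
have liftP := hexes_lift sHG rG oH r_inj r_add.
have liftE := hexval_lift r_add.
have cardI (I : finType) : #|{: I * {z : A | z \in H}}| = (#|I| * #|H|)%N.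
  by rewrite card_prod card_sig.
have [p3|p_neq3] := eqVneq p 3.
  subst p.
  pose q0 : 'F_3 * 'F_3 := (1, - 1).
  (* [K] is the preimage of the line spanned by (1, -1), which the lifted hexads avoid; on that line
     the coordinates add up to 0. *)
  pose K := (<[r q0]> <*> H)%G.
  have sHK : H \subset K := joing_subr _ _.
  have sKG : K \subset G by rewrite join_subG sHG cycle_subG rG.
  have memK q : r q \in K -> q.1 + q.2 = 0.
    rewrite /= cent_joinEr; last by rewrite (centSS sHG _ abG) // cycle_subG rG.
    case/mulsgP => _ h /cycleP[m ->] hH; rewrite FinRing.zmodXgE FinRing.zmodMgE => rq.
    have /r_inj -> : r q - r (q0 *+ m) \in H.
      have := group_sub hH (section_muln r_add q0 m).
      by rewrite rq opprB addrA [h + _]addrC.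
    elim: m {rq} => [|m IHm]; first by rewrite mulr0n addr0.
    by rewrite (mulrS q0) /= addrACA IHm subrr addr0.
  (* The index of [H] in [K] is odd, and it is not 1 since [r q0] lies outside [H]. *)
  have card_K : (3 * #|H| <= #|K|)%N.
    have /dvdnP[m mE] := cardSg sHK.
    have : odd #|K| := dvdn_odd (cardSg sKG) oG.
    rewrite mE oddM => /andP[om _]; rewrite leq_mul2r; apply/orP; right.
    case: m om mE => [|[|[|]]] // _; rewrite mul1n => eKH.
    have /eqP eHK : H == K :> {set A} by rewrite eqEcard sHK eKH /=.
    have : r q0 - r 0 \in H.
      rewrite group_sub ?(section0 r_add) //.
      by rewrite eHK (subsetP (joing_subl _ _)) // cycle_id.
    by move/r_inj/(congr1 fst).
  have ltKn : (#|K| < n)%N.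
    apply: leq_trans (proper_card _) ltGn; rewrite properE sKG /=.
    by apply/negP => /subsetP/(_ _ (rG (1, 0)))/memK.
  have [J [c [d [cardJ hJ]]]] := IHn K ltKn (dvdn_odd (cardSg sKG) oG).
  have [|f [g fg]] := hexes_union sKG hJ (liftP _ _ _ hex_disjoint_F3).
    move=> ih e; apply/negP => memH.
    have := group_add (subsetP sHK _ (liftE _ (fun=> (1, 0)) (fun=> (0, 1)) ih e)) memH.
    rewrite addrNK.
    by move/memK; case: e {memH} => [[[|[|[|//]]] kp] [|]].
  exists _, f, g; split=> //; rewrite card_sum cardI cardG card_unit.
  by move: card_K cardJ; move: #|K| #|J| #|H|; clear; lia.
have p5 : (4 < p)%N.
  by move: p_neq3 p1 op; clear; case: p => [|[|[|[|[|]]]]].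
have [I [a [b [cardI0 dab]]]] := hex_disjoint_Fp2 p_pr p5.
have ltHn : (#|H| < n)%N.
  by apply: leq_trans (_ : _ < #|G|)%N _ => //; rewrite cardG ltn_Pmull // -(exp1n 2) ltn_exp2r.
have [J [c [d [cardJ hJ]]]] := IHn H ltHn oH.
have [|f [g fg]] := hexes_union sHG hJ (liftP _ _ _ dab).
  move=> ih e; apply/negP => memH.
  have /eqP := hex_disjoint_neq0 ih.1 e dab; apply; apply: r_inj.
  rewrite group_sub ?(section0 r_add) //.
  by have := group_add (liftE _ a b ih e) memH; rewrite addrNK.
exists _, f, g; split=> //; rewrite card_sum cardI cardG.
have -> : (p ^ 2 = 6 * #|I| + 1)%N by rewrite cardI0 addn1 prednK // expn_gt0 ltnW.
by move: cardJ; move: #|I| #|J| #|H|; clear; lia.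
Qed.

(** * Balanced assignments *)

Definition signed (A : zmodType) (b : bool) (x : A) : A := if b then - x else x.

Lemma uniq_map_inj (S U : eqType) (f : S -> U) (l : seq S) :
  uniq (map f l) -> {in l &, injective f}.
Proof.
elim: l => //= x l IHl /andP[fx ul] y z; rewrite !inE.
case/orP=> [/eqP->|yl] /orP[/eqP->|zl] // e; last exact: IHl.
  by case/negP: fx; rewrite e map_f.
by case/negP: fx; rewrite -e map_f.
Qed.

Lemma disjoint_setD (S : finType) (V W : {set S}) : [disjoint V & W :\: V].
Proof. by rewrite -setI_eq0 setIDA [V :&: W]setIC -setIDA setDv setI0. Qed.

Section Assignment.
Variables (T : finType) (A : finZmodType).
Variables (rt : T -> T) (col : T -> bool) (bip : pred T).
Implicit Types (V W : {set T}) (X Y : {set A}) (w : T -> A).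

(** Here [rt] stands for the root of a vertex's component, [col] for a 2-colouring and [bip] for
    bipartiteness of the component with a given root. The signed sum is the difference between the
    two colour classes. *)
Definition balanced w := forall r, bip r -> \sum_(v | rt v == r) signed (col v) (w v) = 0.

(** Vanishing outside [V] lets assignments on disjoint sets of vertices be combined by addition. *)
Definition assignable V X := exists w,
  [/\ balanced w, {in V &, injective w}, {in V, forall v, w v \in X}
    & {in ~: V, forall v, w v = 0}].

Lemma signedD b (x y : A) : signed b (x + y) = signed b x + signed b y.
Proof. by case: b; rewrite //= opprD. Qed.

Lemma signed0 b : signed b (0 : A) = 0.
Proof. by case: b; rewrite //= oppr0. Qed.

Lemma assignable0 X : assignable set0 X.
Proof.
exists (fun=> 0); split=> //; try by move=> v ?; rewrite inE.
by move=> r _; rewrite big1 // => v _; rewrite signed0.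
by move=> v; rewrite inE.
Qed.

Lemma assignableU V W X Y : [disjoint V & W] -> [disjoint X & Y] ->
  assignable V X -> assignable W Y -> assignable (V :|: W) (X :|: Y).
Proof.
move=> dVW dXY [f [balf injf fX f0]] [g [balg injg gY g0]].
have eV v : v \in V -> f v + g v = f v.
  by move=> vV; rewrite g0 ?addr0 // inE (disjointFr dVW vV).
have eW v : v \in W -> f v + g v = g v.
  by move=> vW; rewrite f0 ?add0r // inE (disjointFl dVW vW).
exists (fun v => f v + g v); split.
- move=> r br; under eq_bigr do rewrite signedD.
  by rewrite big_split /= balf // balg // addr0.
- move=> u v /setUP[uV|uW] /setUP[vV|vW].
  + by rewrite !eV //; apply: injf.
  + rewrite eV // eW // => e; have := disjointFr dXY (fX _ uV).
    by rewrite e gY.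
  + rewrite eW // eV // => e; have := disjointFr dXY (fX _ vV).
    by rewrite -e gY.
  + by rewrite !eW //; apply: injg.
- move=> v /setUP[vV|vW]; rewrite inE.
    by rewrite eV // fX.
  by rewrite eW // gY // orbT.
- by move=> v; rewrite !inE negb_or => /andP[vV vW]; rewrite f0 ?g0 ?addr0 ?inE.
Qed.

Definition balanced_seq (l : seq (T * A)) := forall r, bip r ->
  \sum_(p <- l | rt p.1 == r) signed (col p.1) p.2 = 0.

Lemma assignable_seq (l : seq (T * A)) : uniq (unzip1 l) -> uniq (unzip2 l) ->
  balanced_seq l -> assignable [set v in unzip1 l] [set x in unzip2 l].
Proof.
move=> u1 u2 bal.
have fst_inj := uniq_map_inj u1; have snd_inj := uniq_map_inj u2.
(* A sum instead of a lookup: balance then follows by exchanging the order of summation. *)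
pose w v := \sum_(p <- l | p.1 == v) p.2.
have wE p : p \in l -> w p.1 = p.2.
  move=> pl; rewrite /w (big_rem p) //= eqxx big_seq_cond big1 ?addr0 // => q.
  have ul : uniq l by apply: map_uniq u1.
  case/andP=> qrem /eqP e; move: qrem.
  by rewrite mem_rem_uniq // !inE => /andP[qp ql]; rewrite (fst_inj q p) ?eqxx in qp.
exists w; split.
- move=> r br; rewrite -[RHS](bal r br) /w.
  under eq_bigr do rewrite (big_morph _ (signedD _) (signed0 _)).
  rewrite (exchange_big_dep (fun p => rt p.1 == r)) /=; last first.
    by move=> v p /eqP <- /eqP->.
  apply: eq_bigr => p /eqP rp; rewrite (big_pred1 p.1) // => v /=.
  by rewrite [p.1 == v]eq_sym; case: (eqVneq v p.1) => [->|]; rewrite ?rp ?eqxx ?andbF.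
- move=> u v; rewrite !inE => /mapP[p pl ->] /mapP[q ql ->]; rewrite !wE // => e.
  by rewrite (snd_inj p q).
- by move=> v; rewrite !inE => /mapP[p pl ->]; rewrite wE // map_f.
- move=> v; rewrite !inE => vl; rewrite /w big_seq_cond big1 // => p /andP[pl /eqP pv].
  by rewrite -pv map_f in vl.
Qed.

(* A non-bipartite component is a single class. *)
Definition cls (v : T) := (rt v, col v && bip (rt v)).
Definition evens W := forall k, ~~ odd #|[set u in W | cls u == k]|.

Lemma evensU V W : [disjoint V & W] -> evens V -> evens W -> evens (V :|: W).
Proof.
move=> dVW eV eW k.
have -> : [set u in V :|: W | cls u == k] =
    [set u in V | cls u == k] :|: [set u in W | cls u == k].
  by apply/setP => u; rewrite !inE andb_orl.
rewrite cardsU; have -> : #|[set u in V | cls u == k] :&: [set u in W | cls u == k]| = 0%N.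
  apply/eqP; rewrite cards_eq0 -subset0; apply/subsetP => u; rewrite !inE.
  by case/andP=> /andP[uV _] /andP[uW _]; rewrite (disjointFr dVW uV) in uW.
by rewrite subn0 oddD (negPf (eV k)) (negPf (eW k)).
Qed.

Lemma card_minus_seq V (vs : seq T) (P : pred T) : uniq vs -> {subset vs <= V} ->
  (#|[set u in V :\: [set v in vs] | P u]| + count P vs = #|[set u in V | P u]|)%N.
Proof.
move=> uvs sub; rewrite -size_filter -(card_uniqP (filter_uniq P uvs)).
rewrite -cardUI [X in (_ + X)%N](_ : _ = 0%N) ?addn0.
  apply: eq_card => u; rewrite !inE mem_filter.
  case: (boolP (u \in vs)) => [/sub->|]; rewrite /= ?andbF ?andbT ?orbF ?orFb //.
apply/eqP/pred0P => u; rewrite /= !inE mem_filter.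
by case: (u \in vs); rewrite /= ?andbF.
Qed.

Lemma evens_minus V (vs : seq T) : uniq vs -> {subset vs <= V} ->
  (forall k, odd #|[set u in V | cls u == k]| = odd (count (fun u => cls u == k) vs)) ->
  evens (V :\: [set v in vs]).
Proof.
move=> uvs sub par k; have := par k.
rewrite -(card_minus_seq (fun u => cls u == k) uvs sub) oddD.
by case: (odd _); case: (odd _).
Qed.

Lemma cls_bal u v r (x : A) : cls u = cls v -> bip r -> rt v == r ->
  signed (col u) x = signed (col v) x.
Proof.
by case=> e1 e2 br /eqP rv; move: e2; rewrite e1 rv br !andbT => ->.
Qed.

(** Evenness provides a second vertex in the class of any vertex; giving the two x and -x keeps the
    balance, and removing them keeps all classes even. *)
Lemma assignable_pairs W X : evens W -> (forall x, x \in X -> - x \in X) ->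
  (forall x, x \in X -> - x != x) -> (#|W| <= #|X|)%N -> assignable W X.
Proof.
have [n] := ubnP #|W|; elim: n W X => // n IHn W X ltWn eW symX neqX leWX.
have [->|[v vW]] := set_0Vmem W; first exact: assignable0.
have [x xX] : exists x, x \in X.
  by apply/card_gt0P; apply: leq_trans leWX; apply/card_gt0P; exists v.
have [u uW /andP[neq_uv /eqP eq_cls]] : exists2 u, u \in W & (u != v) && (cls u == cls v).
  have : (1 < #|[set u in W | cls u == cls v]|)%N.
    have := eW (cls v).
    have : (0 < #|[set u in W | cls u == cls v]|)%N.
      by apply/card_gt0P; exists v; rewrite inE vW eqxx.
    by case: #|_| => [|[|]].
  case/card_gt1P => a [b []]; rewrite !inE => /andP[aW ca] /andP[bW cb] ab.
  by case: (eqVneq a v) ab => [->|nav _]; 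
    [exists b; rewrite // eq_sym ab | exists a; rewrite ?nav].
pose l := [:: (u, x); (v, - x)].
have Vl : [set z in unzip1 l] = [set u; v] by apply/setP => z; rewrite !inE.
have Xl : [set z in unzip2 l] = [set x; - x] by apply/setP => z; rewrite !inE.
have asl : assignable [set u; v] [set x; - x].
  rewrite -Vl -Xl; apply: assignable_seq; rewrite /= ?inE ?andbT //.
    by rewrite eq_sym neqX.
  move=> r br; rewrite !big_cons big_nil /=.
  have -> : (rt u == r) = (rt v == r) by case: eq_cls => ->.
  case: (boolP (rt v == r)) => // rv; rewrite (cls_bal x eq_cls br rv) addr0.
  by rewrite -signedD subrr signed0.
have sV : [set u; v] \subset W by rewrite subUset !sub1set uW vW.
have sX : [set x; - x] \subset X by rewrite subUset !sub1set xX symX.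
have defW : [set u; v] :|: W :\: [set u; v] = W.
  by rewrite -[RHS](setID W [set u; v]) (setIidPr sV).
have defX : [set x; - x] :|: X :\: [set x; - x] = X.
  by rewrite -[RHS](setID X [set x; - x]) (setIidPr sX).
rewrite -defW -defX; apply: assignableU asl _.
- exact: disjoint_setD.
- exact: disjoint_setD.
apply: IHn.
- rewrite -ltnS (leq_trans _ ltWn) // ltnS cardsD (setIidPr sV) cards2 neq_uv.
  by have := subset_leq_card sV; rewrite cards2 neq_uv; lia.
- have -> : [set u; v] = [set z in [:: u; v]] by apply/setP => z; rewrite !inE.
  apply: evens_minus => [|z|k]; first by rewrite /= inE neq_uv.
    by rewrite !inE => /orP[] /eqP->.
  by rewrite (negPf (eW k)) /= eq_cls; case: (_ == k).
- move=> z; rewrite !inE !negb_or => /andP[/andP[zx znx] zX].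
  by rewrite symX // andbT eqr_opp zx andbT eqr_oppLR znx.
- by move=> z /setDP[zX _]; apply: neqX.
- by rewrite !cardsD (setIidPr sV) (setIidPr sX) !cards2 neq_uv [x == _]eq_sym neqX // leq_sub2r.
Qed.
End Assignment.

Lemma perm_swap14 (S : eqType) (a b c d : S) l :
  perm_eq [:: a, b, c, d & l] [:: d, b, c, a & l].
Proof. by apply/seq.permP => P /=; case: (P a); case: (P d); rewrite /= ?addnS. Qed.

Lemma setD_parts (S : finType) (P D U V : {set S}) :
  P \subset D -> D \subset V -> U \subset V :\: D ->
  V :\: (P :|: U) = (D :\: P) :|: ((V :\: D) :\: U).
Proof.
move=> sPD sDV sU; apply/setP => z; rewrite !in_setD !in_setU !in_setD.
case: (boolP (z \in D)) => zD.
  have -> : (z \in U) = false.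
    by apply: contraTF zD => /(subsetP sU); rewrite inE => /andP[].
  by rewrite (subsetP sDV) // orbF andbT orbF.
have -> // : (z \in P) = false.
by apply: contraNF zD => /(subsetP sPD).
Qed.

(** * Hexads absorb the odd classes *)

Section Phase1.
Variables (T : finType) (A : finZmodType).
Variables (rt : T -> T) (col : T -> bool) (bip : pred T).
Implicit Types (V W : {set T}) (X Y : {set A}).

Local Notation cls := (cls rt col bip).
Local Notation evens := (evens rt col bip).
Local Notation balanced_seq := (@balanced_seq T A rt col bip).
Local Notation assignable := (@assignable T A rt col bip).

Definition component v := [set u | rt u == rt v].
Definition side v c := [set u in component v | col u == c].

Lemma balanced_cat l1 l2 :
  balanced_seq l1 -> balanced_seq l2 -> balanced_seq (l1 ++ l2).
Proof. by move=> b1 b2 r br; rewrite big_cat /= b1 // b2 // addr0. Qed.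

Lemma balanced_perm l1 l2 : perm_eq l1 l2 -> balanced_seq l1 -> balanced_seq l2.
Proof. by move=> p12 b1 r br; rewrite -(perm_big _ p12) b1. Qed.

Lemma balanced_star v u1 u2 (x y : A) : rt u1 = rt v -> rt u2 = rt v ->
  (bip (rt v) -> col u1 = ~~ col v /\ col u2 = ~~ col v) ->
  balanced_seq [:: (v, x + y); (u1, x); (u2, y)].
Proof.
move=> r1 r2 c12 r br; rewrite !big_cons big_nil /= r1 r2.
case: eqP => // rv; rewrite -rv in br; have [-> ->] := c12 br.
by case: (col v); rewrite /= addr0 -?opprD ?addNr ?subrr.
Qed.

Lemma balanced_mono v1 v2 v3 (x y : A) : rt v2 = rt v1 -> rt v3 = rt v1 ->
  col v2 = col v1 -> col v3 = col v1 ->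
  balanced_seq [:: (v1, - (x + y)); (v2, x); (v3, y)].
Proof.
move=> r2 r3 c2 c3 r br; rewrite !big_cons big_nil /= r2 r3 c2 c3.
by case: eqP => // rv; rewrite addr0 -!signedD addNr signed0.
Qed.

Lemma card_cls_component v k : #|[set u in component v | cls u == k]| =
  if k.1 == rt v then
    if bip (rt v) then #|side v k.2| else if k.2 then 0%N else #|component v|
  else 0%N.
Proof.
case: k => r c /=; case: eqVneq => [->|nr]; last first.
  apply/eqP; rewrite cards_eq0 -subset0; apply/subsetP => u; rewrite !inE.
  by case/andP => /eqP ru /eqP[ru' _]; rewrite -ru' ru eqxx in nr.
case: (boolP (bip (rt v))) => br.
  apply: eq_card => u; rewrite !inE; case: eqVneq => // ru.
  by rewrite /cls ru br andbT xpair_eqE eqxx.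
case: c; last first.
  apply: eq_card => u; rewrite !inE; case: eqVneq => // ru.
  by rewrite /cls ru (negPf br) andbF !eqxx.
apply/eqP; rewrite cards_eq0 -subset0; apply/subsetP => u; rewrite !inE.
by case/andP => /eqP ru; rewrite /cls ru (negPf br) andbF xpair_eqE andbF.
Qed.

Lemma card_sides v : (#|side v true| + #|side v false| = #|component v|)%N.
Proof.
rewrite -(cardsID [set u | col u] (component v)); congr (_ + _)%N.
  by apply: eq_card => u; rewrite !inE eqb_id.
by apply: eq_card => u; rewrite !inE eqbF_neg andbC.
Qed.

Hypothesis component_gt2 : forall v, (2 < #|component v|)%N.
Hypothesis side_gt0 : forall v c, bip (rt v) -> (0 < #|side v c|)%N.
Hypothesis side_gt2 : forall v c, bip (rt v) ->
  odd #|side v c| -> odd #|side v (~~ c)| -> (2 < #|side v c|)%N.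

(** A bipartite component of odd order has one odd class, which supplies [v], and one even class,
    which supplies [u1] and [u2]; otherwise any three vertices do. Two removals leave even classes:
    all three when the component shares a hexad, and [v] alone when [v] receives 0. *)
Lemma odd_component_star v0 : odd #|component v0| -> exists v u1 u2,
  [/\ [/\ rt v = rt v0, rt u1 = rt v & rt u2 = rt v], uniq [:: v; u1; u2],
    (bip (rt v) -> col u1 = ~~ col v /\ col u2 = ~~ col v),
    evens (component v0 :\: [set z in [:: v; u1; u2]])
  & evens (component v0 :\: [set z in [:: v]])].
Proof.
move=> oC; case: (boolP (bip (rt v0))) => br.
  have [c [oc nc]] : exists c, odd #|side v0 c| /\ ~~ odd #|side v0 (~~ c)|.
    move: oC; rewrite -card_sides oddD.
    by case o1: (odd #|side v0 true|); case o2: (odd #|side v0 false|) => // _;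
      [exists true | exists false]; rewrite /= o1 o2.
  have /card_gt0P[v vs] : (0 < #|side v0 c|)%N by apply: side_gt0.
  have : (1 < #|side v0 (~~ c)|)%N.
    by have := side_gt0 (~~ c) br; move: nc; case: #|_| => [|[|]].
  case/card_gt1P => u1 [u2 []]; move: vs; rewrite !inE.
  move=> /andP[/eqP rv /eqP cv] /andP[/eqP r1 /eqP c1] /andP[/eqP r2 /eqP c2] n12.
  have unq : uniq [:: v; u1; u2].
    rewrite /= !inE n12 andbT negb_or andbT; apply/andP; split.
      by apply: contraTneq isT => e; move: c1; rewrite -e cv; case: (c).
    by apply: contraTneq isT => e; move: c2; rewrite -e cv; case: (c).
  have parity k : odd #|[set u in component v0 | cls u == k]| = (k == (rt v0, c)).
    rewrite card_cls_component br; case: k => r b /=; rewrite xpair_eqE.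
    case: eqVneq => // _; case: (eqVneq b c) => [->//|nbc].
    by have -> : b = ~~ c by [case: (b) (c) nbc => [] []]; apply: negbTE.
  exists v, u1, u2; split=> //; try by rewrite ?r1 ?r2 rv.
  - by rewrite c1 c2 cv.
  - apply: evens_minus => // [z|k].
      by rewrite !inE => /or3P[] /eqP->; rewrite ?rv ?r1 ?r2.
    rewrite parity /= /cls rv r1 r2 br cv c1 c2 !andbT ![_ == k]eq_sym.
    by case: (_ == _); case: (_ == _).
  - apply: evens_minus => // [z|k]; first by rewrite !inE => /eqP->; rewrite rv.
    by rewrite parity /= /cls rv br cv !andbT ![_ == k]eq_sym; case: (_ == _).
have /card_gt2P[v [u1 [u2 [[vC u1C u2C] [n1 n2 n3]]]]] := component_gt2 v0.
move: vC u1C u2C; rewrite !inE => /eqP rv /eqP r1 /eqP r2.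
have parity k : odd #|[set u in component v0 | cls u == k]| = (k == (rt v0, false)).
  rewrite card_cls_component (negPf br); case: k => r b /=; rewrite xpair_eqE.
  by case: eqVneq => // _; case: b.
exists v, u1, u2; split=> //.
- by rewrite r1 r2 rv.
- by rewrite /= !inE n2 negb_or n1 eq_sym n3.
- by rewrite rv (negPf br).
- apply: evens_minus => // [|z|k].
  + by rewrite /= !inE n2 negb_or n1 eq_sym n3.
  + by rewrite !inE => /or3P[] /eqP->; rewrite ?rv ?r1 ?r2.
  + rewrite parity /= /cls rv r1 r2 (negPf br) !andbF ![_ == k]eq_sym.
    by case: (_ == _).
- apply: evens_minus => // [z|k]; first by rewrite !inE => /eqP->; rewrite rv.
  by rewrite parity /= /cls rv (negPf br) !andbF ![_ == k]eq_sym; case: (_ == _).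
Qed.

Variables (I : finType) (a b : I -> A).
Hypothesis dab : hex_disjoint a b.

Definition hexset i := [set hexval (a i) (b i) c | c : 'I_3 * bool].

Lemma assignable_hex i v1 v2 v3 u1 u2 u3 (x := a i) (y := b i)
    (l := [:: (v1, x + y); (v2, x); (v3, y); (u1, - (x + y)); (u2, - x); (u3, - y)]) :
  uniq [:: v1; v2; v3; u1; u2; u3] -> balanced_seq l ->
  assignable [set z in [:: v1; v2; v3; u1; u2; u3]] (hexset i).
Proof.
move=> unq bal; pose cs : seq ('I_3 * bool) :=
  [seq (inord k, false) | k <- iota 0 3] ++ [seq (inord k, true) | k <- iota 0 3].
have csE : [seq hexval x y c | c <- cs] = unzip2 l.
  by rewrite /= /hexval /= !inordK.
have -> : hexset i = [set z in unzip2 l].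
  apply/setP => z; rewrite inE -csE; apply/imsetP/mapP => [[c _ ->]|[c _ ->]]; last by exists c.
  exists c => //; case: c => [[[|[|[|//]]] kp] [|]];
    rewrite !inE !xpair_eqE -!val_eqE /= !inordK //.
apply: (assignable_seq (l := l)) => //.
rewrite -csE map_inj_in_uniq; last by move=> c d _ _ e; have [] := @dab (i, c) (i, d) e.
by rewrite /= !inE !xpair_eqE -!val_eqE /= !inordK.
Qed.

Lemma assignable_stars i v v' u1 u2 u1' u2' :
    uniq [:: v; u1; u2; v'; u1'; u2'] ->
    rt u1 = rt v -> rt u2 = rt v -> rt u1' = rt v' -> rt u2' = rt v' ->
    (bip (rt v) -> col u1 = ~~ col v /\ col u2 = ~~ col v) ->
    (bip (rt v') -> col u1' = ~~ col v' /\ col u2' = ~~ col v') ->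
  assignable [set z in [:: v; u1; u2; v'; u1'; u2']] (hexset i).
Proof.
move=> unq r1 r2 r1' r2' c c'; apply: assignable_hex => //.
set s := (X in balanced_seq X).
apply: (balanced_cat (l1 := take 3 s) (l2 := drop 3 s)); first exact: balanced_star.
by rewrite /= opprD; apply: balanced_star.
Qed.

(** An odd class inside a component of even order forces it to be bipartite with both sides odd, so
    each side has three vertices for a zero-sum triple. *)
Lemma even_component_block v :
  ~~ odd #|component v| -> odd #|[set u in component v | cls u == cls v]| ->
  exists vs : seq T, [/\ uniq vs, size vs = 6, {subset vs <= component v},
    evens (component v :\: [set z in vs]) & forall i, assignable [set z in vs] (hexset i)].
Proof.
rewrite card_cls_component eqxx => eC; case: ifP => [br /= oc|_]; last first.
  by case: ifP => // _ oC; rewrite oC in eC.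
have os c : odd #|side v c|.
  move: eC; rewrite -card_sides oddD; move: oc; rewrite br andbT.
  by case: (col v); case: c => /= ->; case: (odd _).
have /card_gt2P[v1 [v2 [v3 [[]]]]] := side_gt2 br (os true) (os false).
have /card_gt2P[u1 [u2 [u3 [[]]]]] := side_gt2 br (os false) (os true).
rewrite !inE => /andP[/eqP ru1 /eqP cu1] /andP[/eqP ru2 /eqP cu2] /andP[/eqP ru3 /eqP cu3].
move=> [nu1 nu2 nu3].
move=> /andP[/eqP rv1 /eqP cv1] /andP[/eqP rv2 /eqP cv2] /andP[/eqP rv3 /eqP cv3].
move=> [nv1 nv2 nv3].
have neq s t : col s -> col t = false -> s != t.
  by move=> cs ct; apply: contraTneq cs => ->; rewrite ct.
(* [u1] and [v1] are interchanged so that the order of values in [assignable_hex] gives -(x + y), x,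
   y to one side and x + y, -x, -y to the other. *)
have unq : uniq [:: u1; v2; v3; v1; u2; u3].
  rewrite /= !inE !negb_or nu1 nu2 nv2 [u1 == u3]eq_sym nu3 [v2 == v1]eq_sym nv1 nv3.
  by rewrite !(neq v1) ?(neq v2) ?(neq v3) // ![u1 == _]eq_sym !neq.
exists [:: u1; v2; v3; v1; u2; u3]; split=> //.
- by move=> z; rewrite !inE; do !case/orP => [/eqP->|]; [..|move/eqP->]; apply/eqP.
- apply: evens_minus => // [z|k].
    by rewrite !inE; do !case/orP => [/eqP->|]; [..|move/eqP->]; apply/eqP.
  rewrite card_cls_component br; case: k => r c /=.
  rewrite /cls !(rv1, rv2, rv3, ru1, ru2, ru3) br.
  rewrite !(cv1, cv2, cv3, cu1, cu2, cu3) /= !xpair_eqE eq_sym.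
  by case: (_ == _) => //=; rewrite os; case: c.
- move=> i; apply: assignable_hex => //.
  set x := a i; set y := b i.
  apply: (@balanced_perm ([:: (v1, - (x + y)); (v2, x); (v3, y)] ++
     [:: (u1, - (- x + - y)); (u2, - x); (u3, - y)])).
    rewrite !opprD !opprK; exact: perm_swap14.
  apply: balanced_cat; apply: balanced_mono; rewrite ?rv1 ?rv2 ?rv3 ?ru1 ?ru2 ?ru3 //.
  all: by rewrite ?cv1 ?cv2 ?cv3 ?cu1 ?cu2 ?cu3.
Qed.

(** The values spent before pairing starts; [z] will be the parity of the number of vertices. *)
Definition pool (J : {set I}) (z : bool) : {set A} :=
  (\bigcup_(i in J) hexset i) :|: (if z then [set 0] else set0).

Lemma hexset_neq0 i x : x \in hexset i -> x != 0.
Proof. by case/imsetP => c _ ->; apply: hex_disjoint_neq0. Qed.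

Lemma disjoint_hexset i (J : {set I}) z : i \notin J -> [disjoint hexset i & pool J z].
Proof.
move=> niJ; apply/pred0P => x /=; apply/negP => /andP[xi].
rewrite inE => /orP[/bigcupP[j jJ /imsetP[d _ xd]]|].
  case/imsetP: xi => c _ xc; move: niJ; rewrite xc in xd.
  by have [-> _] := @dab (i, c) (j, d) xd; rewrite jJ.
by case: z; rewrite inE // => /eqP x0; have := hexset_neq0 xi; rewrite x0 eqxx.
Qed.

Definition closed_set V := forall u v, v \in V -> rt u = rt v -> u \in V.

(** Any [k] hexads must serve, so that an induction can hand them out one at a time. The exact size
    of [V0] later bounds [k] by the number of available hexads. *)
Definition reducible V := exists k V0,
  [/\ V0 \subset V, #|V0| = (6 * k + odd #|V|)%N, evens (V :\: V0)
    & forall J : {set I}, #|J| = k -> assignable V0 (pool J (odd #|V|))].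

Lemma even_fibres (K : finType) (f : T -> K) V :
  (forall k, ~~ odd #|[set u in V | f u == k]|) -> ~~ odd #|V|.
Proof.
move=> ev; rewrite -sum1_card (partition_big f predT) //=.
apply: (big_ind (fun n => ~~ odd n)) => // [m n em en|k _].
  by rewrite oddD (negPf em) (negPf en).
by move: (ev k); rewrite -sum1_card; under eq_bigl do rewrite inE.
Qed.

(** Since [D] has even order, removing it does not change whether 0 is in the pool; one extra hexad
    pays for the six vertices taken from [D]. *)
Lemma reducible_step V (D : {set T}) (vs : seq T) : D \subset V -> uniq vs -> size vs = 6 ->
  {subset vs <= D} -> ~~ odd #|D| -> evens (D :\: [set z in vs]) ->
  (forall i, assignable [set z in vs] (hexset i)) ->
  reducible (V :\: D) -> reducible V.
Proof.
move=> sDV uvs szvs svs oD eD asg [k [V0 [sV0 cardV0 eV0 asgV0]]].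
have odd_eq : odd #|V :\: D| = odd #|V|.
  by rewrite -[in RHS](cardsID D V) (setIidPr sDV) oddD (negPf oD).
rewrite odd_eq in cardV0 asgV0; set P := [set z in vs] in eD asg.
have sPD : P \subset D by apply/subsetP => z; rewrite inE => /svs.
have cP : #|P| = 6 by rewrite cardsE (card_uniqP uvs).
have dPV0 : [disjoint P & V0].
  apply: disjointWl sPD _; apply: disjointWr sV0 _; exact: disjoint_setD.
exists k.+1, (P :|: V0); split.
- by rewrite subUset (subset_trans sPD) // (subset_trans sV0) ?subsetDl.
- rewrite cardsU (disjoint_setI0 dPV0) cards0 subn0 cP cardV0; lia.
- have -> : V :\: (P :|: V0) = (D :\: P) :|: ((V :\: D) :\: V0).
    exact: setD_parts.
  apply: evensU => //; apply: disjointWl (subsetDl _ _) _; apply: disjointWr (subsetDl _ _) _.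
  exact: disjoint_setD.
move=> J cardJ; have /card_gt0P[i iJ] : (0 < #|J|)%N by rewrite cardJ.
have -> : pool J (odd #|V|) = hexset i :|: pool (J :\ i) (odd #|V|).
  by rewrite /pool (big_setD1 i) //= setUA.
apply: assignableU dPV0 (disjoint_hexset _ _) (asg i) (asgV0 _ _).
  by rewrite !inE eqxx.
by have := cardsD1 i J; rewrite iJ cardJ; case.
Qed.

(** Components are split off by induction: first those of even order with odd classes, each using a
    hexad; then components of odd order, two per hexad. A last one of odd order gives 0 to one
    vertex, and if no such component exists all classes are even. *)
Lemma closed_reducible V : closed_set V -> reducible V.
Proof.
have [n] := ubnP #|V|; elim: n V => // n IHn V ltVn clV.
have sCV v : v \in V -> component v \subset V.
  by move=> vV; apply/subsetP => u; rewrite inE => /eqP; apply: clV.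
have clD v W : closed_set W -> closed_set (W :\: component v).
  move=> clW u w /setDP[wW]; rewrite inE => nw eu.
  by rewrite !inE eu nw (clW _ w).
have IH v : v \in V -> closed_set (V :\: component v) -> reducible (V :\: component v).
  move=> vV; apply: IHn; apply: leq_trans (proper_card _) ltVn.
  apply/properP; split; [exact: subsetDl | exists v => //].
  by rewrite !inE eqxx.
case: (pickP [pred v in V |
    ~~ odd #|component v| && odd #|[set u in component v | cls u == cls v]|]).
  move=> v /and3P[vV eC oc]; have [vs [uvs szvs svs ev asg]] := even_component_block eC oc.
  apply: reducible_step (sCV _ vV) uvs szvs svs eC ev asg (IH _ vV _); exact: clD.
move=> no_even.
case: (pickP [pred v in V | odd #|component v|]) => [v0 /andP[v0V oC]|no_odd]; last first.
  have eV : evens V.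
    move=> k; case: (pickP [pred u in V | cls u == k]) => [v /andP[vV /eqP kE]|none].
      have /= := no_even v; have /= := no_odd v; rewrite vV /= => -> /= /negbT.
      rewrite -kE; congr (~~ odd _); apply: eq_card => u; rewrite !inE.
      case: (eqVneq (cls u) (cls v)) => [[ru _]|]; rewrite ?andbF // ru eqxx.
      by rewrite (clV u v).
    have -> : [set u in V | cls u == k] = set0.
      by apply/setP => u; rewrite !inE; apply: none.
    by rewrite cards0.
  have eV' : ~~ odd #|V| := even_fibres eV.
  exists 0%N, set0; rewrite (negPf eV') sub0set cards0 setD0; split=> // J _.
  exact: assignable0.
have [v [u1 [u2 [[rv r1 r2] unq colv eC3 eC1]]]] := odd_component_star oC.
have clV' := clD v0 V clV.
case: (pickP [pred w in V :\: component v0 | odd #|component w|]) =>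
    [w0 /andP[w0V oC']|no_odd]; last first.
  have eV' : ~~ odd #|V :\: component v0|.
    apply: (even_fibres (f := rt)) => r.
    case: (pickP [pred u in V :\: component v0 | rt u == r]) => [w /andP[wV /eqP rE]|none].
      have /= := no_odd w; rewrite wV /= => /negbT; congr (~~ odd _).
      apply: eq_card => u; rewrite [in RHS]inE inE -rE.
      by case: eqVneq => ru; rewrite ?andbF ?andbT // (clV' u w).
    have -> : [set u in V :\: component v0 | rt u == r] = set0.
      by apply/setP => u; rewrite in_set0 in_set; exact: none.
    by rewrite cards0.
  have [k [V0 [sV0 cardV0 eV0 asgV0]]] := IH v0 v0V clV'.
  have oV : odd #|V|.
    by rewrite -(cardsID (component v0) V) (setIidPr (sCV _ v0V)) oddD oC (negPf eV').
  (* The rest has even order, so its pool does not contain 0, which is free for [v]. *)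
  rewrite (negPf eV') in cardV0 asgV0.
  have vC : v \in component v0 by rewrite inE rv.
  have dvV0 : [disjoint [set v] & V0].
    apply: disjointWr sV0 _; apply: (disjointWl (_ : _ \subset component v0)).
      by rewrite sub1set.
    exact: disjoint_setD.
  exists k, ([set v] :|: V0); rewrite oV; split.
  - by rewrite subUset sub1set (subsetP (sCV _ v0V)) // (subset_trans sV0) ?subsetDl.
  - by rewrite cardsU (disjoint_setI0 dvV0) cards0 subn0 cards1 cardV0 addn0 addnC.
  - have -> : V :\: ([set v] :|: V0) =
        (component v0 :\: [set z in [:: v]]) :|: ((V :\: component v0) :\: V0).
      have -> : [set z in [:: v]] = [set v] by apply/setP => z; rewrite !inE.
      by apply: setD_parts => //; rewrite ?sub1set ?sCV.
    apply: evensU => //; apply: disjointWl (subsetDl _ _) _; apply: disjointWr (subsetDl _ _) _.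
    exact: disjoint_setD.
  move=> J cardJ; have -> : pool J true = [set 0] :|: pool J false.
    by rewrite /pool setU0 setUC.
  apply: assignableU dvV0 _ _ (asgV0 J cardJ).
    rewrite disjoints1 /pool setU0; apply/bigcupP => -[i _ /hexset_neq0].
    by rewrite eqxx.
  have -> : [set v] = [set z in unzip1 [:: (v, 0 : A)]] by apply/setP => z; rewrite !inE.
  have -> : [set 0] = [set z in unzip2 [:: (v, 0 : A)]] by apply/setP => z; rewrite !inE.
  apply: assignable_seq => // r br; rewrite big_cons big_nil /= signed0 addr0.
  by case: ifP.
(* Two components of odd order share one hexad, each taking a sum and its two summands. *)
have [w [t1 [t2 [[rw rt1 rt2] unq' colw eC3' _]]]] := odd_component_star oC'.
move: (w0V); rewrite inE => /andP[w0C w0V'].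
have dCC : [disjoint component v0 & component w0].
  apply/pred0P => z /=; rewrite !inE; apply/negP => /andP[/eqP z1 /eqP z2].
  by case/negP: w0C; rewrite inE -z2 z1.
have sD : component v0 :|: component w0 \subset V by rewrite subUset !sCV.
have mem1 z : z \in [:: v; u1; u2] -> z \in component v0.
  by rewrite !inE => /or3P[] /eqP->; rewrite ?rv ?r1 ?r2 ?rv.
have mem2 z : z \in [:: w; t1; t2] -> z \in component w0.
  by rewrite !inE => /or3P[] /eqP->; rewrite ?rw ?rt1 ?rt2 ?rw.
have unq6 : uniq ([:: v; u1; u2] ++ [:: w; t1; t2]).
  rewrite cat_uniq unq unq' andbT andTb; apply/hasPn => z zt; apply/negP => zu.
  by have := disjointFr dCC (mem1 z zu); rewrite mem2.
apply: (@reducible_step V (component v0 :|: component w0) ([:: v; u1; u2] ++ [:: w; t1; t2])) => //.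
- by move=> z; rewrite mem_cat in_setU => /orP[/mem1->|/mem2->]; rewrite ?orbT.
- by rewrite cardsU (disjoint_setI0 dCC) cards0 subn0 oddD oC oC'.
- have -> : (component v0 :|: component w0) :\: [set z in [:: v; u1; u2] ++ [:: w; t1; t2]] =
     (component v0 :\: [set z in [:: v; u1; u2]]) :|: (component w0 :\: [set z in [:: w; t1; t2]]).
    apply/setP => z; rewrite !in_setD !in_setU !in_setD !in_set mem_cat negb_or.
    case: (boolP (z \in [:: v; u1; u2])) => [/mem1 zC|_] /=.
      by have := disjointFr dCC zC; rewrite !inE => ->; rewrite andbF.
    case: (boolP (z \in [:: w; t1; t2])) => [/mem2 zC|_] //=.
    by have := disjointFl dCC zC; rewrite !inE => ->.
  apply: evensU => //; apply: disjointWl (subsetDl _ _) _; apply: disjointWr (subsetDl _ _) _.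
  exact: dCC.
- by move=> i; apply: assignable_stars.
rewrite -setDDl; apply: IHn; last exact: clD.
apply: leq_ltn_trans (subset_leq_card (subsetDl _ _)) _.
apply: leq_trans (proper_card _) ltVn; apply/properP; split; first exact: subsetDl.
by exists v0; rewrite // !inE eqxx.
Qed.
End Phase1.

(** * Counting hexads and pairs in the whole group *)

Lemma hexvalN (A : zmodType) (a b : A) c :
  hexval a b (c.1, ~~ c.2) = - hexval a b c.
Proof. by case: c => k [|]; rewrite /hexval /= ?opprK. Qed.

Lemma exists_assignment (T : finType) (A : finZmodType)
    (rt : T -> T) (col : T -> bool) (bip : pred T) :
  (forall v, 2 < #|component rt v|)%N ->
  (forall v c, bip (rt v) -> (0 < #|side rt col v c|)%N) ->
  (forall v c, bip (rt v) -> odd #|side rt col v c| ->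
     odd #|side rt col v (~~ c)| -> (2 < #|side rt col v c|)%N) ->
  odd #|A| -> (#|T| + ~~ odd #|T| <= #|A|)%N ->
  exists w : T -> A, balanced rt col bip w /\ injective w.
Proof.
move=> comp2 side0 side2 oA leTA.
have [|I [a [b [leAI [_ dab]]]]] := @hexes_exist A [group of setT]; first by rewrite cardsT.
rewrite cardsT in leAI.
have cl : closed_set rt [set: T] by move=> u v; rewrite !inE.
have [k [V0 [_ cardV0 eV0 asgV0]]] := closed_reducible comp2 side0 side2 dab cl.
rewrite cardsT in cardV0 asgV0.
have leV0 : (#|V0| <= #|T|)%N := max_card _.
(* Apart from the vertex receiving 0 when the order is odd, the vertices are no more numerous than
   the nonzero elements. Hence 6k is at most |A| - 1, which is at most 6|I| + 5. *)
have leTA' : (#|T| - odd #|T| < #|A|)%N.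
  by case oT: (odd #|T|) leTA => /=; [have := odd_gt0 oT | ]; lia.
have leI : (k <= #|I|)%N.
  have lt : (6 * k < 6 * #|I| + 6)%N.
    apply: leq_trans leAI; apply: leq_ltn_trans leTA'.
    by rewrite -(addnK (odd #|T|) (6 * k)%N) -cardV0 leq_sub2r.
  by lia.
have [J cardJ] : exists J : {set I}, #|J| = k.
  have /card_geqP[s [us <- _]] : (k <= #|I|)%N by [].
  by exists [set i in s]; rewrite cardsE; apply/card_uniqP.
have asg0 := asgV0 J cardJ.
pose H := \bigcup_(i in J) hexset a b i.
have cardH : (#|H| <= 6 * k)%N.
  rewrite -cardJ mulnC -sum_nat_const /H.
  elim/big_rec2: _ => [|i U m _ leUm]; first by rewrite cards0.
  apply: leq_trans (leq_card_setU _ _) (leq_add _ leUm).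
  by apply: leq_trans (leq_imset_card _ _) _; rewrite card_prod card_ord card_bool.
(* At least |A| - 1 - 6k elements remain, closed under negation and without 0: enough pairs for the
   vertices outside [V0]. *)
pose X := [set x : A | x != 0] :\: H.
have NH x : (- x \in H) = (x \in H).
  suff sub y : y \in H -> - y \in H by apply/idP/idP => /sub; rewrite ?opprK.
  case/bigcupP => i iJ /imsetP[c _ ->]; apply/bigcupP; exists i => //.
  by rewrite -hexvalN imset_f.
have asg1 : assignable rt col bip (~: V0) X.
  apply: assignable_pairs.
  - by rewrite -setTD.
  - by move=> x; rewrite !inE NH oppr_eq0.
  - move=> x; rewrite !inE => /andP[_ x0]; apply: contraNneq x0 => e.
    apply/eqP; apply: (@double_inj A [group of setT]); rewrite ?inE ?cardsT //.
    by rewrite -{1}e addNr addr0.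
  - have cX0 : #|[set x : A | x != 0]| = #|A|.-1.
      by rewrite -(cardC1 (0 : A)); apply: eq_card => x; rewrite !inE.
    rewrite cardsCs setCK cardV0 cardsD cX0.
    have : (#|[set x : A | x != 0%R] :&: H| <= 6 * k)%N.
      exact: leq_trans (subset_leq_card (subsetIr _ _)) cardH.
    by lia.
have dX : [disjoint pool a b J (odd #|T|) & X].
  apply/pred0P => x /=; apply/negP => /andP[]; rewrite !inE => /orP[xH|x0] /andP[xnH xn0].
    by rewrite xH in xnH.
  by case: (odd _) x0; rewrite inE ?(negPf xn0).
have dV : [disjoint V0 & ~: V0] by rewrite disjoints_subset setCK.
have [w [balw injw _ _]] := assignableU dV dX asg0 asg1.
by exists w; split=> // u v; apply: injw; rewrite setUCr inE.
Qed.

(** * Weights realised by labellings *)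

Section Graph.
Variables (G : sgraph) (A : finZmodType).
Implicit Types (u v r : G) (w : G -> A) (g : A).
Local Notation e := (@sedge G).

Definition achievable w := exists f : {set G} -> A, forall v, wdeg f v = w v.

Definition delta u g v : A := if v == u then g else 0.

Lemma achievable_ext w w' : w =1 w' -> achievable w -> achievable w'.
Proof. by move=> ww' [f fw]; exists f => v; rewrite fw. Qed.

Lemma achievable0 : achievable (fun=> 0).
Proof. by exists (fun=> 0) => v; rewrite /wdeg big1. Qed.

Lemma achievableD w w' : achievable w -> achievable w' ->
  achievable (fun v => w v + w' v).
Proof.
move=> [f fw] [f' fw']; exists (fun S => f S + f' S) => v.
by rewrite -fw -fw' /wdeg big_split.
Qed.

Lemma achievable_sum (I : finType) (W : I -> G -> A) : (forall i, achievable (W i)) ->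
  achievable (fun v => \sum_i W i v).
Proof.
move=> Wi; have aux (s : seq I) : achievable (fun v => \sum_(i <- s) W i v).
  elim: s => [|i s IHs].
    by apply: achievable_ext achievable0 => v; rewrite big_nil.
  by apply: achievable_ext (achievableD (Wi i) IHs) => v; rewrite big_cons.
exact: aux.
Qed.

Lemma achievable_edge u v g : e u v ->
  achievable (fun z => delta u g z + delta v g z).
Proof.
move=> euv; have nuv : u != v by apply: contraTneq euv => ->; rewrite sedge_irrefl.
exists (fun S => if S == [set u; v] then g else 0) => z; rewrite /wdeg /delta.
rewrite -big_mkcondr /=.
have setE y : y != z -> ([set y; z] == [set u; v]) =
    ((z == u) && (y == v)) || ((z == v) && (y == u)).
  move=> nyz; apply/eqP/idP => [/setP E|].
    have := E y; have := E z; rewrite !inE !eqxx orbT /=.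
    move=> /esym/orP[/eqP zE|/eqP zE] /esym/orP[/eqP yE|/eqP yE];
      rewrite zE yE ?eqxx ?orbT //; by rewrite zE yE eqxx in nyz.
  by case/orP => /andP[/eqP-> /eqP->]; rewrite // setUC.
rewrite (eq_bigl (fun y => ((z == u) && (y == v)) || ((z == v) && (y == u)))); last first.
  move=> y; case: (eqVneq y z) => [->|nyz].
    rewrite sedge_irrefl /=; apply/esym/negP => /orP[] /andP[/eqP-> /eqP E];
    by rewrite E eqxx in nuv.
  rewrite setE // andbC; case: (boolP (_ || _)) => //= /orP[] /andP[/eqP-> /eqP->] //.
  by rewrite sedge_sym.
case: (eqVneq z u) => [->|nzu] /=.
  rewrite (negPf nuv) /= addr0 (big_pred1 v) // => y.
  by rewrite /= orbF.
case: (eqVneq z v) => [_|nzv] /=; last by rewrite big_pred0 // addr0.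
by rewrite add0r (big_pred1 u).
Qed.

(* The bipartite double cover, whose walks record the parity of their length. *)
Definition cover_edge : rel (G * bool) :=
  [rel p q | e p.1 q.1 && (q.2 == ~~ p.2)].

Lemma cover_sym : symmetric cover_edge.
Proof.
move=> [u b] [v c]; rewrite /cover_edge /= sedge_sym; congr andb.
by case: b; case: c.
Qed.

Lemma cover_connect_sym : connect_sym cover_edge.
Proof. exact: sym_connect_sym cover_sym. Qed.

Lemma edge_connect_sym : connect_sym e.
Proof. exact: sym_connect_sym (@sedge_sym G). Qed.

Lemma cover_flip u v b c : connect cover_edge (u, b) (v, c) ->
  connect cover_edge (u, ~~ b) (v, ~~ c).
Proof.
case/connectP => p; elim: p u b => [|[z d] p IHp] u b /=.
  by move=> _ [-> ->].
case/andP => /andP[/= euz /eqP->] pp lastp.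
apply: connect_trans (IHp _ _ pp lastp); apply: connect1.
by rewrite /cover_edge /= euz /=.
Qed.

Lemma cover_lift u v b : connect e u v -> exists c, connect cover_edge (u, b) (v, c).
Proof.
case/connectP => p; elim: p u b => [|z p IHp] u b /=.
  by move=> _ ->; exists b.
case/andP => euz pp lastp; have [c zc] := IHp z (~~ b) pp lastp.
exists c; apply: connect_trans zc; apply: connect1.
by rewrite /cover_edge /= euz eqxx.
Qed.

(** Labels of alternating sign along a walk cancel at every intermediate visit; the second
    coordinate in the cover carries the sign. *)
Lemma achievable_cover p q g : connect cover_edge p q ->
  achievable (fun z => delta p.1 (signed p.2 g) z - delta q.1 (signed q.2 g) z).
Proof.
case/connectP => s; elim: s p => [|z s IHs] p /=.
  by move=> _ ->; apply: achievable_ext achievable0 => v; rewrite subrr.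
case/andP => /andP[epz /eqP z2] ps lasts.
have := achievableD (achievable_edge (signed p.2 g) epz) (IHs z ps lasts).
apply: achievable_ext => v; rewrite z2 addrA; congr (_ - _); rewrite -addrA -[RHS]addr0.
by congr (_ + _); rewrite /delta; case: ifP; rewrite ?addr0 //;
  case: (p.2); rewrite /= ?addNr ?subrr.
Qed.

Definition rep v := fingraph.root e v.
(** A walk in the cover from (r, false) to (r, true) is an odd closed walk at [r]. In [colour]
    below, false means that an even walk from the root exists, so a non-bipartite component is
    entirely coloured false. *)
Definition bipartite r := ~~ connect cover_edge (r, false) (r, true).
Definition colour v := ~~ connect cover_edge (rep v, false) (v, false).

Lemma rep_connect u v : (rep u == rep v) = connect e u v.
Proof. exact/root_connect/edge_connect_sym. Qed.

Lemma colour_connect v : connect cover_edge (rep v, false) (v, colour v).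
Proof.
have [|c vc] := @cover_lift (rep v) v false.
  by rewrite edge_connect_sym connect_root.
rewrite /colour; case: (boolP (connect cover_edge (rep v, false) (v, false))) => //= nc.
by case: c vc => // vc; rewrite vc in nc.
Qed.

(** An edge with ends of one colour would close an odd walk at the root. *)
Lemma bipartite_colour u v : e u v -> bipartite (rep u) -> colour v = ~~ colour u.
Proof.
move=> euv br; have ruv : rep u = rep v by apply/eqP; rewrite rep_connect connect1.
apply: contraNeq br => ncol.
have {ncol} E : colour u = colour v by case: (colour u) (colour v) ncol => [] [].
have c1 : connect cover_edge (rep u, false) (v, ~~ colour u).
  apply: connect_trans (colour_connect u) (connect1 _).
  by rewrite /cover_edge /= euv eqxx.
have := cover_flip (colour_connect v); rewrite cover_connect_sym -E -ruv /= => c2.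
exact: connect_trans c1 c2.
Qed.

(** Walks to the root realise each [w v] at the price of a signed copy at the root. What must be
    restored there is the signed sum of the component: it is 0 in the bipartite case and is supplied
    by an odd closed walk otherwise. *)
Lemma balanced_achievable w : odd #|A| -> balanced rep colour bipartite w -> achievable w.
Proof.
move=> oA balw.
(* Half of g is its multiple by (|A| + 1)/2, since |A| annihilates g. *)
have half g : exists h, h + h = g.
  exists (g *+ (#|A|.+1)./2); rewrite -mulrnDr addnn halfK /= oA subn0.
  have -> : #|A|.+1 = (1 + #|[set: A]|)%N by rewrite cardsT.
  rewrite mulrnDr mulr1n -[X in _ + X](FinRing.zmodXgE #|[set: A]| g).
  by rewrite (expg_cardG (G := [group of setT])) ?inE // FinRing.zmod1gE addr0.
pose S r := \sum_(v | rep v == r) signed (colour v) (w v).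
have aS r : achievable (delta r (S r)).
  case: (boolP (bipartite r)) => [br|].
    by apply: achievable_ext achievable0 => v; rewrite /delta /S balw // if_same.
  (* Along the odd closed walk the two end terms are h and -(-h), so the root receives 2h. *)
  rewrite negbK => cr; have [h hS] := half (S r).
  apply: achievable_ext (achievable_cover h cr) => v /=.
  by rewrite /delta; case: ifP; rewrite ?subr0 // opprK hS.
have a1 v : achievable (fun z => delta v (w v) z - delta (rep v) (signed (colour v) (w v)) z).
  have := achievable_cover (signed (colour v) (w v))
    (_ : connect cover_edge (v, colour v) (rep v, false)).
  rewrite cover_connect_sym colour_connect => /(_ isT); apply: achievable_ext => z /=.
  by rewrite /signed; case: (colour v); rewrite ?opprK.
have := achievableD (achievable_sum a1) (achievable_sum aS).
apply: achievable_ext => z; rewrite sumrB.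
have -> : \sum_i delta i (w i) z = w z.
  rewrite (bigD1 z) //= big1 ?addr0 /delta ?eqxx // => i.
  by rewrite eq_sym => /negPf->.
have -> : \sum_i delta i (S i) z = S z.
  rewrite (bigD1 z) //= big1 ?addr0 /delta ?eqxx // => i.
  by rewrite eq_sym => /negPf->.
suff -> : \sum_i delta (rep i) (signed (colour i) (w i)) z = S z by rewrite subrK.
by rewrite /S [RHS]big_mkcond; apply: eq_bigr => i _; rewrite /delta eq_sym.
Qed.
End Graph.

Local Close Scope ring_scope.

(** * Component sizes and excluded stars *)

Lemma star_iso (G : sgraph) (C : {set G}) (x : G) (r : nat) :
  x \in C -> #|C :\ x| = r ->
  {in C, forall y, y != x -> sedge x y} ->
  {in C &, forall y z, y != x -> z != x -> ~~ sedge y z} ->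
  graph_iso (induced C) (star r).
Proof.
move=> xC cardD ex ne; set D := C :\ x in cardD.
have sz : size (enum D) = r by rewrite -cardE.
(* [x] is not listed in [enum D], so its index is [r], [insub] fails, and [x] goes to the centre
   [None]. *)
pose f (z : induced C) : star r := insub (index (val z) (enum D)).
have ltD (z : induced C) : (index (val z) (enum D) < r) = (val z != x).
  by rewrite -sz index_mem mem_enum !inE (valP z) andbT.
have fN z : (f z == None) = (val z == x).
  by rewrite /f; case: insubP => [i|]; rewrite ltD ?negbK; [move/negPf-> | move->].
exists f.
  apply: inj_card_bij; last first.
    by rewrite card_option card_ord card_sig -cardD (cardsD1 x C) xC.
  move=> y z fyz; apply: val_inj; have := fN y; have := fN z; rewrite -fyz.
  case: (eqVneq (val y) x) => [->|yx]; case: (eqVneq (val z) x) => [->|zx] //;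
    [by move=> -> | by move=> -> |] => _ _.
  have yD : val y \in enum D by rewrite mem_enum !inE yx (valP y).
  have zD : val z \in enum D by rewrite mem_enum !inE zx (valP z).
  move: fyz; rewrite /f.
  rewrite !insubT ?ltD // => yi zi [] e.
  by rewrite -(nth_index x yD) e nth_index.
move=> y z; rewrite /sedge /= /star_edge /= !fN /induced_edge /=.
case: (eqVneq (val y) x) => [yx|yx]; case: (eqVneq (val z) x) => [zx|zx] /=.
- by rewrite yx zx sedge_irrefl.
- by rewrite yx ex // (valP z).
- by rewrite zx sedge_sym ex // (valP y).
- by apply/esym/negbTE; apply: ne => //; [exact: valP y | exact: valP z].
Qed.

Section Components.
Variable G : sgraph.
Hypothesis components_ge3 : forall C : {set G}, C \in components G -> 3 <= #|C|.
Hypothesis no_odd_star : forall (C : {set G}) (u : nat), C \in components G -> 1 <= u ->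
  ~ graph_iso (induced C) (star (2 * u + 1)).

Lemma comp_component (v : G) : component (@rep G) v \in components G.
Proof.
apply/imsetP; exists v => //; apply/setP => u.
by rewrite !inE eq_sym rep_connect.
Qed.

Lemma component_gt2 (v : G) : 2 < #|component (@rep G) v|.
Proof. exact/components_ge3/comp_component. Qed.

Lemma neighbour (v : G) : exists u, sedge v u.
Proof.
have /card_gt1P[a [b []]] : 1 < #|component (@rep G) v| := ltnW (component_gt2 v).
rewrite !inE ![_ == rep v]eq_sym !rep_connect => va vb ab.
have [z vz zv] : exists2 z, connect (@sedge G) v z & z != v.
  by case: (eqVneq a v) ab => [->|av _]; [exists b; rewrite // eq_sym | exists a].
case/connectP: vz => [[|u p] /=]; first by move=> _ zE; rewrite zE eqxx in zv.
by case/andP=> vu _ _; exists u.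
Qed.

Lemma side_neighbour (v : G) c : bipartite (rep v) -> exists2 u, u \in side (@rep G) (@colour G) v c &
  sedge v u || (u == v).
Proof.
move=> br; case: (eqVneq c (colour v)) => [->|nc].
  by exists v; rewrite ?inE ?eqxx ?orbT.
have [u vu] := neighbour v; exists u; rewrite ?vu // !inE (bipartite_colour vu br).
rewrite eq_sym rep_connect connect1 //=.
by case: c (colour v) nc => [] [].
Qed.

Lemma side_gt0 (v : G) c : bipartite (rep v) -> 0 < #|side (@rep G) (@colour G) v c|.
Proof. by case/(side_neighbour c) => u us _; apply/card_gt0P; exists u. Qed.

(** An odd side with fewer than three vertices is a single vertex. All others then have the opposite
    colour and are adjacent to it alone, giving a star with an odd number of leaves, at least three
    as the component has order at least three. *)
Lemma side_gt2 (v : G) c : bipartite (rep v) -> odd #|side (@rep G) (@colour G) v c| ->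
  odd #|side (@rep G) (@colour G) v (~~ c)| -> 2 < #|side (@rep G) (@colour G) v c|.
Proof.
move=> br oc onc; rewrite ltnNge; apply/negP => le2.
have /eqP/cards1P[x xE] : #|side (@rep G) (@colour G) v c| = 1.
  by move: oc le2; case: #|_| => [|[|[|]]].
have xs : x \in side (@rep G) (@colour G) v c by rewrite xE set11.
move: (xs); rewrite inE => /andP[xC /eqP cx].
have sides : #|side (@rep G) (@colour G) v c| + #|side (@rep G) (@colour G) v (~~ c)|
    = #|component (@rep G) v|.
  by rewrite -(card_sides (@rep G) (@colour G)); case: (c) => //=; rewrite addnC.
have cardD : #|component (@rep G) v :\ x| = #|side (@rep G) (@colour G) v (~~ c)|.
  apply/eqP; rewrite -(eqn_add2l 1); move: sides.
  by rewrite xE cards1 (cardsD1 x (component _ v)) xC => ->.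
have gt1 : 1 < #|side (@rep G) (@colour G) v (~~ c)|.
  by have := component_gt2 v; rewrite -sides xE cards1 add1n.
have colC y : y \in component (@rep G) v -> y != x -> colour y = ~~ c.
  move=> yC yx; have : y \notin side (@rep G) (@colour G) v c by rewrite xE inE.
  by rewrite inE yC /=; case: (c); case: (colour y).
have rE y : y \in component (@rep G) v -> rep y = rep v by rewrite inE => /eqP.
apply: (@no_odd_star (component (@rep G) v) (#|side (@rep G) (@colour G) v (~~ c)|./2)).
- exact: comp_component.
- by move: gt1; case: #|_| => [|[|]].
apply: (star_iso xC).
- by rewrite cardD addn1 mul2n -add1n -{1}(odd_double_half #|_|) onc.
- move=> y yC yx; have [z yz] := neighbour y.
  have bry : bipartite (rep y) by rewrite (rE y yC).
  have zC : z \in component (@rep G) v.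
    by rewrite inE -(rE y yC) eq_sym rep_connect connect1.
  have zs : z \in side (@rep G) (@colour G) v c.
    by rewrite inE zC (bipartite_colour yz bry) (colC y) //= negbK.
  by move: zs; rewrite xE inE => /eqP zx; rewrite -zx sedge_sym.
- move=> y z yC zC yx zx; apply/negP => yz.
  have := bipartite_colour yz; rewrite (rE y yC) => /(_ br).
  by rewrite (colC y) // (colC z) //; case: (c).
Qed.

Lemma odd_group_irregular (A : finZmodType) : odd #|A| ->
  #|G| + ~~ odd #|G| <= #|A| -> exists f : {set G} -> A, irregular f.
Proof.
move=> oA leGA.
have [w [balw injw]] := exists_assignment component_gt2 side_gt0 side_gt2 oA leGA.
have [f fw] := balanced_achievable oA balw.
by exists f => u v; rewrite !fw; apply: contraNneq => /injw->.
Qed.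
End Components.

(** * Lower bounds and the parity obstruction *)

Lemma irregular_card (G : sgraph) (t : nat) :
  0 < t -> all_groups_irregular G t -> #|G| <= t.
Proof.
case: t => // t _ /(_ 'I_t.+1 (card_ord _))[f irr].
rewrite -[t.+1]card_ord; apply: (leq_card (wdeg f)) => u v e.
by apply/eqP; apply: contraTT isT => /irr; rewrite e eqxx.
Qed.

Lemma sum_wdeg_double (G : sgraph) (A : finZmodType) (f : {set G} -> A) :
  exists s : A, (\sum_v wdeg f v = s + s)%R.
Proof.
pose F (v u : G) := f [set u; v].
(* An arbitrary linear order on the vertices, so that the sum [s] counts each edge once; the other
   end of each edge contributes the second copy. *)
pose before (u v : G) := ltn (enum_rank u) (enum_rank v).
exists (\sum_v \sum_(u | sedge v u && before u v) F v u)%R.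
have -> : (\sum_v wdeg f v = \sum_v \sum_(u | sedge v u && before u v) F v u
   + \sum_v \sum_(u | sedge v u && before v u) F v u)%R.
  rewrite -big_split; apply: eq_bigr => v _.
  rewrite /wdeg (bigID (fun u => before u v)) /=; congr (_ + _)%R.
  apply: eq_bigl => u; rewrite /before /= -leqNgt leq_eqVlt.
  case: (eqVneq u v) => [->|uv]; first by rewrite sedge_irrefl.
  suff -> : (enum_rank v == enum_rank u :> nat) = false by [].
  by apply/negbTE; apply: contraNneq uv => /val_inj/enum_rank_inj->.
congr (_ + _)%R; rewrite (exchange_big_dep predT) //=.
apply: eq_bigr => v _; apply: eq_big => [u|u _]; last by rewrite /F setUC.
by rewrite sedge_sym.
Qed.

(* In the cyclic group of order [#|G|] the weights add up to a double, which is
   even, whereas all elements add up to an odd number. *)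
Lemma irregular_not_2mod4 (G : sgraph) :
  #|G| = 2 %[mod 4] -> ~ all_groups_irregular G #|G|.
Proof.
move=> n2 irrG; have [m nE] : exists m, #|G| = m.+1.
  by case: #|G| n2 => [|m _] //; exists m.
have [f irr] := irrG 'I_m.+1 (etrans (card_ord _) (esym nE)).
have injw : injective (wdeg f).
  by move=> u v e; apply/eqP; apply: contraTT isT => /irr; rewrite e eqxx.
have [s sE] := sum_wdeg_double f.
have em : odd m by lia.
(* Parity survives reduction because the modulus [m.+1] is even. *)
have parD (x y : 'I_m.+1) : odd (x + y)%R = odd x (+) odd y.
  by rewrite -oddD [in RHS](divn_eq (x + y) m.+1) oddD oddM /= em andbF.
have bij : bijective (wdeg f) by apply: inj_card_bij injw _; rewrite card_ord nE.
have sumE : (\sum_v wdeg f v = \sum_(x : 'I_m.+1) x)%R.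
  by rewrite (reindex (wdeg f)) //; apply: onW_bij.
have : odd (\sum_(x : 'I_m.+1) x)%R = false by rewrite -sumE sE parD addbb.
rewrite (big_morph (fun x : 'I_m.+1 => odd x) parD (erefl : odd (0%R : 'I_m.+1) = false)).
rewrite -(big_morph odd oddD (erefl : odd 0 = false)).
rewrite -(big_mkord predT id) /=.
(* The sum is m times (m + 1)/2, and both factors are odd because m + 1 is 2 modulo 4. *)
rewrite bin2_sum bin2 /=; set q := m.+1 %/ 4.
have -> : m.+1 = ((2 * q).+1).*2 by rewrite /q; lia.
by rewrite -doubleMl doubleK oddM /= mul2n odd_double /= em.
Qed.

Theorem theorem2p4 (G : sgraph) (n : nat)
    (order_G : #|G| = n)
    (components_ge3 : forall C : {set G}, C \in components G -> 3 <= #|C|)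
    (no_odd_star : forall (C : {set G}) (u : nat), C \in components G -> 1 <= u ->
       ~ graph_iso (induced C) (star (2 * u + 1))) :
  [/\ n = 1 %[mod 2] -> is_sg G n,
      n = 2 %[mod 4] -> is_sg G (n + 1) &
      n = 0 %[mod 4] -> exists s : nat, is_sg G s /\ s <= n + 1].
Proof.
have irrS : ~~ odd n -> all_groups_irregular G (n + 1).
  move=> en A cardA; apply: odd_group_irregular => //; rewrite cardA ?order_G ?en //.
  by rewrite addn1 /= en.
(* The clause [0 < n] covers the empty graph, whose strength is 1 because group orders are
   positive. *)
have sgS : ~~ odd n -> ~ (0 < n /\ all_groups_irregular G n) -> is_sg G (n + 1).
  move=> en nirr; split; [by rewrite addn1 | exact: irrS |] => t t0 irrt.
  have := irregular_card t0 irrt; rewrite order_G leq_eqVlt addn1.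
  by case/orP => // /eqP nt; case: nirr; rewrite nt.
split=> [n1|n2|n0].
- have on : odd n by lia.
  split; first by case: (n) on.
    move=> A cardA; apply: odd_group_irregular => //; rewrite cardA // order_G on addn0 //.
  by move=> t t0 irrt; rewrite -order_G; apply: irregular_card.
- apply: sgS; first lia.
  by case=> _; rewrite -order_G; apply: irregular_not_2mod4; rewrite order_G.
have en : ~~ odd n by lia.
(* The strength is [n] or [n + 1] according to whether all groups of order [n] admit an irregular
   labeling. *)
case: (classic (0 < n /\ all_groups_irregular G n)) => [[n_gt0 irrn]|nirr].
  exists n; split; last by rewrite leq_addr.
  by split=> // t t0 irrt; rewrite -order_G; apply: irregular_card.
by exists (n + 1); split; first exact: sgS.
Qed.
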